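(* Let $p$ be odd, let $\alpha\in R^*\setminus R^{*2}$. Let $Q$ be a quadratic form over $R$ equivalent to $\bigoplus_{i\in\mathbb N}\pi^iQ_i$, where each $Q_i$ is a unimodular quadratic form of rank $r_i$ and discriminant $d_i$, almost all zero. Let $r=\sum_i r_i$, $r_{\mathrm{even}}=\sum_i r_{2i}$, $r_{\mathrm{odd}}=\sum_i r_{2i+1}$, $d=\prod_i d_i$, $d_{\mathrm{even}}=\prod_i d_{2i}$, $d_{\mathrm{odd}}=\prod_i d_{2i+1}$ (as unit square classes). Write the Igusa local zeta function as $Z_Q(t)=f(t)/g(t)$ with $f,g\in\mathbb Q[t]$ coprime and $g(0)=1$. Let $\mathcal L=\{(0,1),(1,1),(1,\alpha),(2,-\alpha)\}$ (pairs of rank and square class). (a) If $r=0$, then $g(t)=1$. (b) If $r>0$ and $\{(r_{\mathrm{even}},d_{\mathrm{even}}),(r_{\mathrm{odd}},d_{\mathrm{odd}})\}\subseteq\mathcal L$, then $g(t)=1-t/q^{r/2}$ if $r_{\mathrm{even}}=r_{\mathrm{odd}}$, and $g(t)=1-t^2/q^r$ if $r_{\mathrm{even}}\neq r_{\mathrm{odd}}$. (c) If $r>0$ and $\{(r_{\mathrm{even}},d_{\mathrm{even}}),(r_{\mathrm{odd}},d_{\mathrm{odd}})\}\not\subseteq\mathcal L$, then: if $r_{\mathrm{even}}\equiv r_{\mathrm{odd}}\equiv1\pmod2$, $g(t)=1-t/q$; if $r_{\mathrm{even}}\equiv r_{\mathrm{odd}}\equiv0\pmod2$, $g(t)=(1-t/q)(1-\eta((-1)^{r/2}d)t/q^{r/2})$;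 if $r_{\mathrm{even}}\not\equiv r_{\mathrm{odd}}\pmod2$, $g(t)=(1-t/q)(1-t^2/q^r)$.
   Context: $K$ is a $p$-adic field with valuation ring $R$, uniformizer $\pi$, residue field $\mathbb F_q$. $Z_f(t)=\sum_{k\ge0}\mathrm{Vol}\{x\in R^n:v_\pi(f(x))=k\}t^k$ (normalized Haar measure, $t=q^{-s}$) is the Igusa local zeta function, a rational function of $t$. A quadratic form over $R$ is $x^TMx$ with $M$ symmetric over $R$; unimodular means $\det M\in R^*$ (zero form: rank 0, discriminant 1); discriminant is the class of $\det M$ modulo $R^{*2}$; equivalence is invertible $R$-linear change of variables; $\oplus$ is a sum in disjoint variables. $\eta(b)=1$ for $b\in R^{*2}$, $\eta(b)=-1$ for $b\in R^*\setminus R^{*2}$. *)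

(* Defs.v *)
From HB Require Import structures.
From mathcomp Require Import all_boot all_order all_algebra.
From mathcomp Require Import all_classical all_reals all_analysis.

Set Implicit Arguments.
Unset Strict Implicit.
Unset Printing Implicit Defensive.

Import Order.TTheory GRing.Theory Num.Theory.

Local Open Scope classical_set_scope.
Local Open Scope ring_scope.

(* Valuations take values in Z u {+oo}, seen inside \bar int. *)
Record valuedField := ValuedField {
  vf_sort :> fieldType;
  valuation : vf_sort -> \bar int;
  valuation_neqNy : forall x, valuation x != -oo%E;
  valuation_eqy : forall x, (valuation x == +oo%E) = (x == 0);
  valuationM : forall x y, valuation (x * y) = (valuation x + valuation y)%E;
  valuationD : forall x y,
    (Order.min (valuation x) (valuation y) <= valuation (x + y))%E }.

Section ValuationRing.
Variable K : valuedField.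
Implicit Types x y : K.
Local Notation v := (@valuation K).

Lemma valuation0 : v 0 = +oo%E.
Proof. by apply/eqP; rewrite valuation_eqy. Qed.

Lemma valuation_fin x : x != 0 -> exists k : int, v x = k%:E.
Proof.
move=> x0; have := valuation_neqNy x; have := valuation_eqy x.
by case: (v x) => [k _ _|/esym|//]; [exists k | rewrite eqxx (negbTE x0)].
Qed.

Lemma valuation1 : v 1 = 0%E.
Proof.
have [k vk] := valuation_fin (oner_neq0 K).
have := valuationM (1 : K) 1; rewrite mulr1 vk -EFinD => -[].
by move/(canLR (addrK _)); rewrite subrr => <-.
Qed.

Lemma valuationV x : x != 0 -> (v x + v x^-1)%E = 0%E.
Proof. by move=> x0; rewrite -valuationM mulfV// valuation1. Qed.

Lemma valuationN1 : v (-1) = 0%E.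
Proof.
have N10 : (-1 : K) != 0 by rewrite oppr_eq0 oner_neq0.
have [k vk] := valuation_fin N10.
have := valuationM (-1 : K) (-1); rewrite mulrNN mulr1 valuation1 vk -EFinD.
by move=> -[/esym/eqP]; rewrite -mulr2n mulrn_eq0/= => /eqP ->.
Qed.

Lemma valuationN x : v (- x) = v x.
Proof. by rewrite -mulN1r valuationM valuationN1 add0e. Qed.

Definition integral : {pred K} := fun x => (0 <= v x)%E.

Lemma integral_subring : subring_closed integral.
Proof.
split=> [|x y|x y]; rewrite ?unfold_in.
- by rewrite valuation1.
- move=> x0 y0; apply: le_trans (valuationD _ _).
  by rewrite valuationN le_min x0.
- by move=> x0 y0; rewrite valuationM adde_ge0.
Qed.

HB.instance Definition _ := GRing.isSubringClosed.Build K integral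
  integral_subring.

Record valuationRing := Integral {
  ival :> K;
  ivalP : ival \in integral }.

HB.instance Definition _ := [isSub for ival].
HB.instance Definition _ := [Choice of valuationRing by <:].
HB.instance Definition _ := [SubChoice_isSubComNzRing of valuationRing by <:].

Definition ival_unit : pred valuationRing := fun a => v (ival a) == 0%E.

Lemma ival_unit_neq0 (a : valuationRing) : ival_unit a -> ival a != 0.
Proof.
by apply: contraL => /eqP a0; rewrite /ival_unit a0 valuation0.
Qed.

Lemma ival_unitV (a : valuationRing) :
  ival_unit a -> (ival a)^-1 \in integral.
Proof.
move=> ua; rewrite unfold_in.
have := valuationV (ival_unit_neq0 ua).
by rewrite (eqP ua) add0e => ->.
Qed.

Definition ival_inv (a : valuationRing) : valuationRing :=
  insubd a (ival a)^-1.

Lemma ival_mulVr : {in ival_unit, left_inverse 1 ival_inv *%R}.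
Proof.
move=> a ua; apply: val_inj => /=.
by rewrite val_insubd ival_unitV// mulVf// ival_unit_neq0.
Qed.

Lemma ival_unitP (a b : valuationRing) : b * a = 1 -> ival_unit a.
Proof.
move=> /(congr1 (fun c => v (ival c))); rewrite /= valuationM valuation1.
have /= := ivalP a; have := ivalP b; rewrite !unfold_in /ival_unit.
move=> b0 a0 ba; rewrite eq_le a0 andbT -ba leeDr//.
Qed.

Lemma ival_inv_out : {in [predC ival_unit], ival_inv =1 id}.
Proof.
move=> a; rewrite inE /= => ua; rewrite /ival_inv; apply: val_inj.
rewrite val_insubd; case: ifPn => //; rewrite unfold_in => a0.
have [a00|an0] := eqVneq (ival a) 0; first by rewrite /= a00 invr0.
have := ivalP a; rewrite unfold_in => a1.
case/negP: ua; change (v (ival a) == 0%E); rewrite eq_le a1 andbT.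
by rewrite -(valuationV an0) leeDl.
Qed.

HB.instance Definition _ := GRing.ComNzRing_hasMulInverse.Build valuationRing
  ival_mulVr ival_unitP ival_inv_out.

Lemma ival_mulf_eq0 (a b : valuationRing) :
  a * b = 0 -> (a == 0) || (b == 0).
Proof.
move=> /(congr1 ival)/= /eqP; rewrite mulf_eq0.
by rewrite -!(inj_eq val_inj).
Qed.

HB.instance Definition _ :=
  GRing.ComUnitRing_isIntegral.Build valuationRing ival_mulf_eq0.

End ValuationRing.

(* A p-adic field: a field of characteristic 0, complete for a normalized
   discrete valuation, with finite residue field of characteristic p. *)
Record padicField (p : nat) := PadicField {
  padic_valuedField :> valuedField;
  residueField : finFieldType;
  residue : {rmorphism valuationRing padic_valuedField -> residueField};
  residue_surj : forall c, exists a, residue a = c;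
  residue_eq0 : forall a,
    residue a = 0 <-> (0 < valuation (ival a))%E;
  residue_pchar : p \in [pchar residueField];
  padic_pchar : [pchar padic_valuedField] =i pred0;
  padic_normalized : exists x : padic_valuedField, valuation x = 1%E;
  padic_complete : forall u : nat -> padic_valuedField,
    (forall e : int, exists k, forall i j, (k <= i)%N -> (k <= j)%N ->
      (e%:E <= valuation (u i - u j))%E) ->
    exists l, forall e : int, exists k, forall i, (k <= i)%N ->
      (e%:E <= valuation (u i - l))%E }.

Section Padic.
Variables (p : nat) (K : padicField p).
Local Notation R := (valuationRing K).

Definition vpi (a : R) : \bar int := valuation (ival a).

Definition uniformizer (a : R) : Prop := vpi a = 1%E.

Definition unit_square (b : R) : Prop :=
  exists2 u : R, u \is a GRing.unit & b = u ^+ 2.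

Definition same_class (a b : R) : Prop :=
  exists2 u : R, u \is a GRing.unit & a = b * u ^+ 2.

(* Only meaningful for units b. *)
Definition unit_eta (b : R) : rat := if `[< unit_square b >] then 1 else -1.

Definition unimodular (n : nat) (M : 'M[R]_n) : Prop :=
  M^T = M /\ \det M \is a GRing.unit.

Definition qform (n : nat) (M : 'M[R]_n) (x : 'cV[R]_n) : R :=
  (x^T *m M *m x) 0 0.

(* U and V are inverse to each other; letting n and n' be a priori different
   avoids casts between propositionally equal dimensions. *)
Definition qform_equiv (n n' : nat) (M : 'M[R]_n) (M' : 'M[R]_n') : Prop :=
  exists (U : 'M[R]_(n, n')) (V : 'M[R]_(n', n)),
    [/\ U *m V = 1%:M, V *m U = 1%:M & M' = U^T *m M *m U].

(* The orthogonal sum of the pi^i Q_i for i < N, followed by the zero form in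
   m variables. *)
Definition jordan_form (pi : R) (r : nat -> nat)
    (Qs : forall i, 'M[R]_(r i)) (N m : nat) :
    'M[R]_(\sum_(i < N) r i + m) :=
  block_mx (\mxdiag_(i < N) (pi ^+ i *: Qs i)) 0 0 (0 : 'M[R]_m).

Definition rank_class_list (alpha : R) : seq (nat * R) :=
  [:: (0%N, 1); (1%N, 1); (1%N, alpha); (2%N, - alpha)].

Definition in_rank_classes (l : seq (nat * R)) (rd : nat * R) : Prop :=
  exists2 c, c \in l & rd.1 = c.1 /\ same_class rd.2 c.2.

Definition padic_open (n : nat) : set (set 'cV[R]_n) :=
  [set U : set 'cV[R]_n | forall x, U x -> exists e : nat, forall y : 'cV[R]_n,
     (forall i : 'I_n, (e%:Z%:E <= vpi ((y - x) i 0)%R)%E) -> U y].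

HB.instance Definition _ := isPointed.Build R 0.

(* R^n with its Borel sigma-algebra. *)
Definition Rn (n : nat) : measurableType (@padic_open n).-sigma :=
  g_sigma_algebraType (@padic_open n).

Definition normalized_haar (T : realType) (n : nat)
    (mu : {measure set Rn n -> \bar T}) : Prop :=
  mu setT = 1%E /\
  forall (x : 'cV[R]_n) (A : set (Rn n)), measurable A ->
    mu [set x + y | y in (A : set 'cV[R]_n)] = mu A.

(* Z_f(t) as a formal power series: igusa_zeta mu f k is the coefficient of
   t^k. *)
Definition igusa_zeta (T : realType) (n : nat)
    (mu : {measure set Rn n -> \bar T}) (f : 'cV[R]_n -> R) (k : nat) : T :=
  fine (mu [set x : Rn n | vpi (f x) = k%:Z%:E]).

End Padic.

(* The power series Z is f / g in lowest terms with g(0) = 1; the coefficient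
   identities say g * Z = f. *)
Definition reduced_fraction (T : realType) (Z : nat -> T)
    (f g : {poly rat}) : Prop :=
  [/\ coprimep f g, g.[0] = 1 &
      forall k : nat,
        \sum_(i < k.+1) ratr g`_i * Z (k - i)%N = ratr f`_k].

(* Main.v *)
(**
After diagonalizing over R, the form is Q_e(x) = sum_{i in J} pi^(e i) a_i x_i^2
with unit coefficients a_i.  Let S be the set of the i in J with e i = 0.  The
points x with some x_i, i in S, not divisible by pi are smooth, so they
contribute to Z explicitly: Q_e is equidistributed along x_i.  On the remaining
points, substituting pi x_i for x_i (i in S) gives pi Q_{e'} with
e' i = |e i - 1|.  Hence
   Z_e(t) = A_S(t) + q^-s t Z_{e'}(t),   s = #|S|,
where counting points on a quadric over the residue field yields
   A_S = (1 - 1/q) a_S / (1 - t/q),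
   a_S = 1 - q^-s t                        for s odd,
   a_S = (1 - eps u) (1 + eps u t)         for s even, u = q^-(s/2),
eps being the quadratic character of the signed discriminant.  Each step
exchanges the parts of even and odd exponent, and once all e i <= 1 two steps
give back the same form, so that (1 - q^-r t^2) Z = A_even + q^-r_even t A_odd.

The poles other than t = q are read off from this last equation.  At t = q, all
the a_S take nonnegative values, and a_S(q) = 0 exactly when the form indexed by
S is anisotropic modulo pi, i.e. when its rank and discriminant lie in the list
L; hence no cancellation occurs in the residue at t = q.
*)

Require Import Defs.
From HB Require Import structures.
From mathcomp Require Import all_boot all_order all_algebra.
From mathcomp Require Import all_classical all_reals all_analysis.
From mathcomp Require Import ring lra zify.
Import Order.TTheory GRing.Theory Num.Theory.
Local Open Scope classical_set_scope.
Local Open Scope ring_scope.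

Set Implicit Arguments.
Unset Strict Implicit.
Unset Printing Implicit Defensive.

(** * Formal power series that are quotients of polynomials *)

Section SeriesFraction.
Variable F : fieldType.
Implicit Types (z : nat -> F) (f g h : {poly F}).

Definition series_fraction z f g :=
  forall k, \sum_(i < k.+1) g`_i * z (k - i)%N = f`_k.

Lemma dvdXnP K f : reflect (forall k, (k < K)%N -> f`_k = 0) ('X^K %| f).
Proof.
apply: (iffP idP) => [/dvdpP[h ->] k kK|f0]; first by rewrite coefMXn kK.
rewrite -(poly_take_drop K f) dvdp_add ?dvdp_mulIr//.
suff -> : take_poly K f = 0 by rewrite dvdp0.
by apply/polyP => k; rewrite coef_take_poly coef0; case: ltnP => // /f0.
Qed.

(** Below degree [K], the coefficients of [g] times the series involve only the [z i] with [i < K].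
    Truncation thus turns identities of power series into divisibilities by powers of ['X]. *)
Lemma series_fractionP z f g :
  series_fraction z f g <-> forall K, 'X^K %| g * \poly_(i < K) z i - f.
Proof.
have E K k : (k < K)%N ->
    (g * \poly_(i < K) z i)`_k = \sum_(i < k.+1) g`_i * z (k - i)%N.
  move=> kK; rewrite coefM; apply: eq_bigr => i _.
  by rewrite coef_poly (leq_ltn_trans (leq_subr _ _) kK).
split=> [zfg K|zfg k].
  by apply/dvdXnP => k kK; rewrite coefB E// zfg subrr.
have /dvdXnP/(_ k (ltnSn k))/eqP := zfg k.+1.
by rewrite coefB E// subr_eq0 => /eqP.
Qed.

Lemma dvdXn_eq0 f : (forall K, 'X^K %| f) -> f = 0.
Proof.
by move=> f0; apply/polyP => k; rewrite coef0; have /dvdXnP-> := f0 k.+1.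
Qed.

Lemma coprimep_Xn_unit K g : g.[0] != 0 -> coprimep 'X^K g.
Proof.
move=> g0; apply: coprimep_expl; rewrite coprimep_sym -['X]subr0 -polyC0.
by rewrite coprimep_XsubC.
Qed.

(** Modulo every ['X^K], both sides equal [g * g'] times the truncated series. *)
Lemma series_fraction_cross z f g f' g' :
  series_fraction z f g -> series_fraction z f' g' -> f * g' = f' * g.
Proof.
move=> /series_fractionP zfg /series_fractionP zfg'; apply/eqP.
rewrite -subr_eq0; apply/eqP/dvdXn_eq0 => K.
set Z := \poly_(i < K) z i.
have -> : f * g' - f' * g = g * (g' * Z - f') - g' * (g * Z - f) by ring.
by rewrite dvdp_sub// dvdp_mull.
Qed.

(** This makes the denominator of the theorem well defined. By coprimality the cross relation gives
    divisibility both ways, and the constant terms fix the remaining scalar. *)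
Lemma series_fraction_unique z f g f' g' :
  coprimep f g -> g.[0] = 1 -> series_fraction z f g ->
  coprimep f' g' -> g'.[0] = 1 -> series_fraction z f' g' -> g = g'.
Proof.
move=> cfg g0 zfg cfg' g0' zfg'.
have cross := series_fraction_cross zfg zfg'.
have gg' : g %| g'.
  by rewrite -(Gauss_dvdpr _ (_ : coprimep g f)) ?cross ?dvdp_mulIr// coprimep_sym.
have g'g : g' %| g.
  by rewrite -(Gauss_dvdpr _ (_ : coprimep g' f')) -?cross ?dvdp_mulIr// coprimep_sym.
have /eqpP[[a b]/= /andP[a0 b0] abE] : g %= g' by rewrite /eqp gg' g'g.
have := congr1 (fun h => h.[0]) abE; rewrite !hornerZ g0 g0' !mulr1 => abE'.
by apply: (scalerI a0); rewrite abE abE'.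
Qed.

(** A polynomial with nonzero constant term is coprime to ['X^K], so it can be cancelled from the
    divisibilities. *)
Lemma series_fraction_cancel z f g h : h.[0] != 0 ->
  series_fraction z (h * f) (h * g) -> series_fraction z f g.
Proof.
move=> h0 /series_fractionP zfg; apply/series_fractionP => K.
rewrite -(Gauss_dvdpr _ (coprimep_Xn_unit K h0)).
by rewrite mulrBr mulrA.
Qed.

(** The conditional is the k-th coefficient of t times [z'], so the hypothesis reads z = A + c t
    z'. *)
Lemma series_fraction_recursion z A z' c a P f g :
  (forall k, z k = A k + c * (if k is k'.+1 then z' k' else 0)) ->
  series_fraction A a P -> series_fraction z' f g ->
  series_fraction z (a * g + c *: 'X * f * P) (P * g).
Proof.
move=> zE /series_fractionP AP /series_fractionP zP.
apply/series_fractionP => K.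
set Z := \poly_(i < K) z i; set A' := \poly_(i < K) A i.
set Z' := \poly_(i < K) z' i.
have ZE : 'X^K %| Z - A' - c *: 'X * Z'.
  apply/dvdXnP => k kK; rewrite !coefB -scalerAl coefZ coefXM !coef_poly kK zE.
  case: k kK => [|k] kK /=; first by ring.
  by rewrite (ltnW kK); ring.
have -> : P * g * Z - (a * g + c *: 'X * f * P) =
  P * g * (Z - A' - c *: 'X * Z') + g * (P * A' - a)
  + c *: 'X * P * (g * Z' - f).
  by ring.
by rewrite !dvdp_add// dvdp_mull// ?AP ?zP.
Qed.

(** Substituting the second relation into the first gives (1 - c c' t^2) z = A + c t A'. *)
Lemma series_fraction_loop z z' A A' c c' a a' P :
  (forall k, z k = A k + c * (if k is k'.+1 then z' k' else 0)) ->
  (forall k, z' k = A' k + c' * (if k is k'.+1 then z k' else 0)) ->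
  series_fraction A a P -> series_fraction A' a' P ->
  series_fraction z (a + c *: 'X * a') (P * (1 - (c * c') *: 'X^2)).
Proof.
move=> zE zE' /series_fractionP AP /series_fractionP AP'.
apply/series_fractionP => K.
set Z := \poly_(i < K) z i; set B := \poly_(i < K) A i.
set Z' := \poly_(i < K) z' i; set B' := \poly_(i < K) A' i.
have ZE : 'X^K %| Z - B - c *: 'X * Z'.
  apply/dvdXnP => k kK; rewrite !coefB -scalerAl coefZ coefXM !coef_poly kK zE.
  case: k kK => [|k] kK /=; first by ring.
  by rewrite (ltnW kK); ring.
have ZE' : 'X^K %| Z' - B' - c' *: 'X * Z.
  apply/dvdXnP => k kK; rewrite !coefB -scalerAl coefZ coefXM !coef_poly kK zE'.
  case: k kK => [|k] kK /=; first by ring.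
  by rewrite (ltnW kK); ring.
have -> : P * (1 - (c * c') *: 'X^2) * Z - (a + c *: 'X * a') =
  P * (Z - B - c *: 'X * Z') + P * (c *: 'X) * (Z' - B' - c' *: 'X * Z)
  + (P * B - a) + c *: 'X * (P * B' - a').
  by rewrite -!mul_polyC polyCM; ring.
apply: dvdp_add; last exact: dvdp_mull (AP' K).
apply: dvdp_add; last exact: AP.
by apply: dvdp_add; apply: dvdp_mull.
Qed.

End SeriesFraction.

(** * The quadratic character and densities of diagonal quadrics over a finite field *)

Section QuadraticCharacter.
Variable F : finFieldType.
Hypothesis two_neq0 : (2 : F) != 0.
Local Notation q := (#|F|%:R : rat).

(** Defined as the number of square roots minus one, so that point counts are character sums. *)
Definition quadratic_char (y : F) : rat :=
  (\sum_(x : F) (x ^+ 2 == y)%:R) - 1.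
Local Notation chi := quadratic_char.

Lemma card_field_gt1 : 1 < q.
Proof. by rewrite ltr1n card_finNzRing_gt1. Qed.

Lemma natr_pred_card : #|F|.-1%:R = q - 1.
Proof.
by rewrite -subn1 natrB// ltnW// card_finNzRing_gt1.
Qed.

Lemma quadratic_char0 : chi 0 = 0.
Proof.
rewrite /quadratic_char (bigD1 0)//= expr0n eqxx big1 ?addr0 ?subrr// => x x0.
by rewrite sqrf_eq0 (negbTE x0).
Qed.

Lemma quadratic_char_sqr x : x != 0 -> chi (x ^+ 2) = 1.
Proof.
move=> x0; rewrite /quadratic_char (bigD1 x)//= eqxx (bigD1 (- x))/=; last first.
  rewrite -subr_eq0 -opprD oppr_eq0 -mulr2n -mulr_natr mulf_neq0//.
rewrite sqrrN eqxx big1 ?addr0 ?addrK// => y /andP[yx yNx].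
by rewrite eqf_sqr (negbTE yx) (negbTE yNx).
Qed.

Lemma quadratic_char1 : chi 1 = 1.
Proof. by rewrite -(quadratic_char_sqr (oner_neq0 _)) expr1n. Qed.

Lemma quadratic_char_nonsqr y : (forall x, x ^+ 2 != y) -> chi y = -1.
Proof.
move=> yN; rewrite /quadratic_char big1 ?sub0r// => x _.
by rewrite (negbTE (yN x)).
Qed.

Variant quadratic_char_spec (y : F) : rat -> Prop :=
| QuadraticChar0 of y = 0 : quadratic_char_spec y 0
| QuadraticCharSqr x of x != 0 & y = x ^+ 2 : quadratic_char_spec y 1
| QuadraticCharNonsqr of y != 0 & (forall x, x ^+ 2 != y) :
    quadratic_char_spec y (- 1).

Lemma quadratic_charP y : quadratic_char_spec y (chi y).
Proof.
have [->|y0] := eqVneq y 0; first by rewrite quadratic_char0; constructor.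
have [/existsP[x /eqP xy]|/existsPn yN] := boolP [exists x, x ^+ 2 == y].
  have x0 : x != 0 by apply: contraNneq y0 => x0; rewrite -xy x0 expr0n.
  by rewrite -xy quadratic_char_sqr//; econstructor; eauto.
by rewrite quadratic_char_nonsqr//; constructor.
Qed.

Lemma quadratic_char_sqrM x y : x != 0 -> chi (x ^+ 2 * y) = chi y.
Proof.
move=> x0; rewrite /quadratic_char; congr (_ - 1).
rewrite (reindex_inj (mulfI x0)) /=; apply: eq_bigr => t _.
by rewrite exprMn (inj_eq (mulfI _))// sqrf_eq0.
Qed.

Lemma sum_quadratic_char : \sum_y chi y = 0.
Proof.
rewrite sumrB sumr_const exchange_big/=.
under eq_bigr => x _.
  rewrite (bigD1 (x ^+ 2))//= eqxx big1 ?addr0; last first.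
    by move=> y yx; rewrite eq_sym (negbTE yx).
  over.
by rewrite sumr_const subrr.
Qed.

Lemma quadratic_charM : {morph chi : x y / x * y}.
Proof.
move=> a b.
case: (quadratic_charP a) => [->|x x0 ->|a0 aN].
- by rewrite !mul0r quadratic_char0.
- by rewrite quadratic_char_sqrM// mul1r.
case: (quadratic_charP b) => [->|x x0 ->|b0 bN].
- by rewrite !mulr0 quadratic_char0.
- by rewrite mulrC quadratic_char_sqrM// (quadratic_char_nonsqr aN) mulr1.
rewrite mulrNN mulr1.
(* the terms of this vanishing sum have constant sign *)
have : \sum_y (- (chi y + chi (a * y))) = 0.
  rewrite sumrN big_split/= sum_quadratic_char add0r.
  have -> : \sum_y chi (a * y) = \sum_y chi y.
    by rewrite [RHS](reindex_inj (mulfI a0)).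
  by rewrite sum_quadratic_char oppr0.
move=> /eqP; rewrite psumr_eq0 => [/allP/(_ b)|y _].
  rewrite mem_index_enum oppr_eq0 (quadratic_char_nonsqr bN) => /(_ isT)/eqP.
  by move/eqP; rewrite addrC subr_eq0 => /eqP.
rewrite oppr_ge0; case: (quadratic_charP y) => [->|x x0 ->|y0 yN].
- by rewrite mulr0 quadratic_char0 addr0.
- by rewrite mulrC quadratic_char_sqrM// (quadratic_char_nonsqr aN) subrr.
- by case: (quadratic_charP (a * y)) => [_|x _ _|_ _]; lra.
Qed.

Lemma quadratic_char_sqr1 y : y != 0 -> chi y ^+ 2 = 1.
Proof.
by case: (quadratic_charP y) => [->|x _ _ _|_ _ _];
  rewrite ?eqxx// ?expr1n// sqrrN expr1n.
Qed.

Lemma quadratic_char_eq_sign y : y != 0 -> (chi y == 1) || (chi y == -1).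
Proof. by case: (quadratic_charP y) => [->||]//; rewrite eqxx. Qed.

(** For [b] nonzero, the sum is the number of points of x^2 = t^2 + b minus q. With x = t + u the
    equation becomes linear in t: one solution for each nonzero u and none for u = 0, hence q - 1
    points. *)
Lemma sum_quadratic_char_sqrD b :
  \sum_t chi (t ^+ 2 + b) = q * (b == 0)%:R - 1.
Proof.
have [->|b0] := eqVneq b 0.
  rewrite mulr1 (bigD1 0)//= expr0n addr0 quadratic_char0 add0r.
  under eq_bigr => t t0 do rewrite addr0 quadratic_char_sqr//.
  by rewrite sumr_const cardC1 natr_pred_card.
rewrite mulr0 sub0r sumrB sumr_const.
under eq_bigr => t _ do rewrite (reindex_inj (addrI t)) /=.
rewrite exchange_big/= (bigD1 0)//= big1 ?add0r; last first.
  by move=> t _; rewrite addr0 -subr_eq0 opprD addrA subrr sub0r oppr_eq0 (negbTE b0).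
under eq_bigr => u u0.
  have E t : ((t + u) ^+ 2 == t ^+ 2 + b) = (t == (b / u - u) / 2).
    rewrite -subr_eq0 -[RHS]subr_eq0.
    have -> : (t + u) ^+ 2 - (t ^+ 2 + b) = 2 * u * (t - (b / u - u) / 2).
      by field; rewrite two_neq0.
    by rewrite mulf_eq0 mulf_eq0 (negbTE two_neq0) (negbTE u0).
  rewrite (bigD1 ((b / u - u) / 2))//= E eqxx big1 ?addr0; last first.
    by move=> t tN; rewrite E (negbTE tN).
  over.
by rewrite sumr_const cardC1 natr_pred_card addrAC subrr sub0r.
Qed.

Lemma sum_quadratic_char_quadratic a b : a != 0 ->
  \sum_t chi (a * t ^+ 2 + b) = chi a * (q * (b == 0)%:R - 1).
Proof.
move=> a0; have -> : (b == 0) = (b / a == 0) by rewrite mulf_eq0 invr_eq0 (negbTE a0) orbF.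
rewrite -sum_quadratic_char_sqrD mulr_sumr; apply: eq_bigr => t _.
by rewrite -quadratic_charM; congr quadratic_char; field.
Qed.

Section Density.
Variables (n : nat) (b : 'I_n -> F).
Local Notation V := 'cV[F]_n.

Definition mean (f : V -> rat) : rat := q ^- n * \sum_c f c.

Lemma card_neq0 : q != 0.
Proof. by have := card_field_gt1; case: eqP => // ->. Qed.

Lemma mean1 : mean (fun=> 1) = 1.
Proof.
by rewrite /mean sumr_const card_mx muln1 natrX mulVf// expf_neq0// card_neq0.
Qed.

(** As [G] ignores translations of its first argument along coordinate [i], that coordinate acts as
    an independent uniform variable. *)
Lemma mean_coord i (G : V -> F -> rat) :
  (forall c t y, G (c + t *: delta_mx i 0) y = G c y) ->
  mean (fun c => G c (c i 0)) = q^-1 * \sum_t mean (G^~ t).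
Proof.
move=> GE; rewrite /mean -mulr_sumr mulrCA; congr (_ * _).
apply: (mulfI card_neq0); rewrite mulrA divff ?card_neq0// mul1r.
transitivity (\sum_(t : F) \sum_c G c (c i 0)).
  by rewrite sumr_const mulr_natl.
transitivity (\sum_c \sum_t G c (c i 0 + t)).
  rewrite [RHS]exchange_big/=; apply: eq_bigr => t _.
  rewrite (reindex_inj (addIr (t *: delta_mx i 0 : V))) /=.
  by apply: eq_bigr => c _; rewrite GE !mxE !eqxx mulr1.
rewrite [RHS]exchange_big/=; apply: eq_bigr => c _.
by rewrite [RHS](reindex_inj (addrI (c i 0))).
Qed.

Definition diag_value (l : seq 'I_n) (c : V) : F :=
  \sum_(i <- l) b i * c i 0 ^+ 2.

Definition sign_disc (s : nat) (d : F) : F := (-1) ^+ s./2 * d.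

(** Induction on the list of variables. Adding a variable to an odd number of them leads to the
    character sum of a quadratic polynomial; adding one to an even number leads to a count of square
    roots. *)
Lemma mean_diag_value l y : uniq l -> (forall i, b i != 0) ->
  mean (fun c => (diag_value l c == y)%:R) =
  q^-1 + (if odd (size l)
    then chi (sign_disc (size l) (\prod_(i <- l) b i) * y) * q ^- (size l)./2.+1
    else chi (sign_disc (size l) (\prod_(i <- l) b i)) * q ^- (size l)./2
         * ((y == 0)%:R - q^-1)).
Proof.
move=> + b0; elim: l y => [|i l IH] y /=.
  move=> _; rewrite /sign_disc big_nil mul1r.
  rewrite quadratic_char1 mul1r expr0 invr1 mul1r addrC subrK.
  rewrite /mean; under eq_bigr => c _ do rewrite /diag_value big_nil eq_sym.
  rewrite sumr_const card_mx muln1 -[_ *+ (_ ^ _)]mulr_natl natrX mulrA mulVf ?mul1r//.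
  by rewrite expf_neq0// card_neq0.
move=> /andP[il ul].
have GE c t x : (diag_value l (c + t *: delta_mx i 0) + b i * x ^+ 2 == y)
    = (diag_value l c + b i * x ^+ 2 == y).
  congr (_ + _ == _); rewrite /diag_value !big_seq; apply: eq_bigr => j jl.
  rewrite !mxE; have [ji|ji] := eqVneq j i; first by rewrite -ji jl in il.
  by rewrite mulr0 addr0.
have -> : mean (fun c => (diag_value (i :: l) c == y)%:R) =
   mean (fun c => (diag_value l c + b i * c i 0 ^+ 2 == y)%:R).
  congr (_ * _); apply: eq_bigr => c _.
  by rewrite /diag_value big_cons addrC.
rewrite (@mean_coord i (fun c x => (diag_value l c + b i * x ^+ 2 == y)%:R));
  last by move=> c t x; rewrite GE.
have E t : mean (fun c => (diag_value l c + b i * t ^+ 2 == y)%:R) =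
   mean (fun c => (diag_value l c == y - b i * t ^+ 2)%:R).
  congr (_ * _); apply: eq_bigr => c _.
  by rewrite -(inj_eq (addIr (- (b i * t ^+ 2)))) addrK.
rewrite (eq_bigr _ (fun t _ => etrans (E t) (IH _ ul))).
rewrite big_cons; set d := \prod_(j <- l) b j; set s := size l.
rewrite big_split/= sumr_const mulrDr.
have q0 := card_neq0.
have -> : q^-1 * (q^-1 *+ #|F|) = q^-1 by rewrite -[X in _ * X]mulr_natr mulVf// mulr1.
congr (_ + _); rewrite /sign_disc /= !uphalf_half; case: (odd s) => /=.
  rewrite -mulr_suml.
  set k := (-1) ^+ _ * d.
  under eq_bigr => t _.
    have -> : k * (y - b i * t ^+ 2) = (- (k * b i)) * t ^+ 2 + k * y by ring.
    over.
  have k0 : k != 0.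
    by rewrite mulf_neq0 ?signr_eq0// prodf_seq_neq0; apply/allP => j _; apply/implyP.
  rewrite sum_quadratic_char_quadratic; last by rewrite oppr_eq0 mulf_neq0.
  rewrite mulf_eq0 (negbTE k0)/= add1n.
  have -> : (-1) ^+ s./2.+1 * (b i * d) = - (k * b i) by rewrite /k exprS; ring.
  by rewrite exprS; field; rewrite q0 expf_neq0.
rewrite add0n -mulr_sumr sumrB sumr_const.
set k := (-1) ^+ _ * d.
have -> : (-1) ^+ s./2 * (b i * d) * y = k * (b i * y) by rewrite /k; ring.
rewrite [chi (k * _)]quadratic_charM.
(* The equation b t^2 = y is equivalent to (b t)^2 = b y. *)
have -> : \sum_t (y - b i * t ^+ 2 == 0)%:R = chi (b i * y) + 1.
  rewrite /quadratic_char subrK [RHS](reindex_inj (mulfI (b0 i))) /=.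
  apply: eq_bigr => t _; congr (nat_of_bool _)%:R.
  have -> : (b i * t) ^+ 2 = b i * (b i * t ^+ 2) by ring.
  by rewrite (inj_eq (mulfI (b0 i))) subr_eq0 eq_sym.
rewrite -[X in _ - X]mulr_natr mulVf// addrK exprS.
by field; rewrite q0 expf_neq0.
Qed.

Lemma mean_coords0 (l : seq 'I_n) : uniq l ->
  mean (fun c => (all (fun i => c i 0 == 0) l)%:R) = q ^- size l.
Proof.
elim: l => [|i l IH] /=; first by rewrite mean1 expr0 invr1.
move=> /andP[il ul].
have -> : mean (fun c => ((c i 0 == 0) && all (fun j => c j 0 == 0) l)%:R) =
   mean (fun c => (c i 0 == 0)%:R * (all (fun j => c j 0 == 0) l)%:R).
  by congr (_ * _); apply: eq_bigr => c _; rewrite -natrM mulnb.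
rewrite (@mean_coord i
  (fun c x => (x == 0)%:R * (all (fun j => c j 0 == 0) l)%:R)); last first.
  move=> c t x; congr (_ * (nat_of_bool _)%:R); apply: eq_in_all => j jl.
  rewrite !mxE; have [ji|ji] := eqVneq j i; first by rewrite -ji jl in il.
  by rewrite mulr0 addr0.
rewrite (bigD1 0)//= eqxx big1 ?addr0; last first.
  by move=> t t0; rewrite /mean big1 ?mulr0// => c _; rewrite (negbTE t0) mul0r.
rewrite exprS invfM -IH//; congr (_ * (_ * _)); apply: eq_bigr => c _.
by rewrite mul1r.
Qed.

End Density.
End QuadraticCharacter.

(** * The local factors of a diagonal form *)

Lemma horner_addcX (F : comNzRingType) (c x : F) :
  (1 + c *: 'X : {poly F}).[x] = 1 + c * x.
Proof. by rewrite -polyC1 hornerD hornerZ hornerX hornerC. Qed.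

Lemma horner_subcX (F : comNzRingType) (c x : F) :
  (1 - c *: 'X : {poly F}).[x] = 1 - c * x.
Proof. by rewrite -polyC1 hornerD hornerN hornerZ hornerX hornerC. Qed.

Lemma horner_subcX2 (F : comNzRingType) (c x : F) :
  (1 - c *: 'X^2 : {poly F}).[x] = 1 - c * x ^+ 2.
Proof. by rewrite -polyC1 hornerD hornerN hornerZ hornerXn hornerC. Qed.

Definition horner_unitE := (horner_addcX, horner_subcX, horner_subcX2).

Section DiagonalZeta.
Variable F : finFieldType.
Hypothesis two_neq0 : (2 : F) != 0.
Local Notation q := (#|F|%:R : rat).
Local Notation chi := (@quadratic_char F).
Variables (n : nat) (b : 'I_n -> F).
Hypothesis b_neq0 : forall i, b i != 0.
Implicit Types (S : {set 'I_n}) (e : 'I_n -> nat).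

Let q_gt1 : 1 < q := card_field_gt1 F.
Let q_neq0 : q != 0 := card_neq0 F.

Definition disc_sign S : rat := chi (sign_disc #|S| (\prod_(i in S) b i)).

Definition zero_density S : rat :=
  q^-1 + (if odd #|S| then 0 else disc_sign S * q ^- #|S|./2 * (1 - q^-1)).

Lemma disc_signP S : disc_sign S = 1 \/ disc_sign S = -1.
Proof.
have : sign_disc #|S| (\prod_(i in S) b i) != 0.
  by rewrite mulf_neq0 ?signr_eq0// prodf_seq_neq0; apply/allP => j _; apply/implyP.
by move=> /(quadratic_char_eq_sign two_neq0)/orP[]/eqP; [left | right].
Qed.

Lemma mean_zero_density S :
  mean (fun c => (diag_value b (enum S) c == 0)%:R) = zero_density S.
Proof.
rewrite mean_diag_value ?enum_uniq// -cardE eqxx mulr0 quadratic_char0 mul0r.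
by rewrite /zero_density /disc_sign -big_enum.
Qed.

Definition linear_factor : {poly rat} := 1 - q^-1 *: 'X.
Local Notation P := linear_factor.

(** This is a_S, with eps given by [disc_sign S] and u by [q ^- #|S|./2]. *)
Definition local_poly S : {poly rat} :=
  if odd #|S| then 1 - q ^- #|S| *: 'X
  else (1 - disc_sign S * q ^- #|S|./2)%:P
       * (1 + (disc_sign S * q ^- #|S|./2) *: 'X).

(** The coefficients of A_S. Valuation 0 means a residue that is not a zero of the form. For
    positive k the residue is a zero with a nonzero coordinate in [S], and above it the valuation is
    k on a proportion q^-(k-1) (1 - 1/q). *)
Definition smooth_series S (k : nat) : rat :=
  if k is k'.+1 then q ^- k' * (1 - q^-1) * (zero_density S - q ^- #|S|)
  else 1 - zero_density S.

Lemma coef_linear_sum (a c : rat) (z : nat -> rat) k :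
  \sum_(i < k.+1) (a%:P + c *: 'X)`_i * z (k - i)%N =
  a * z k + (if k is k'.+1 then c * z k' else 0).
Proof.
rewrite big_ord_recl subn0 coefD coefC coefZ coefX/= mulr0 addr0; congr (_ + _).
case: k => [|k]; first by rewrite big_ord0.
rewrite big_ord_recl big1 /= => [|i _].
  by rewrite coefD coefC coefZ coefX/= mulr1 add0r addr0 subn1.
by rewrite coefD coefC coefZ coefX/= mulr0 add0r mul0r.
Qed.

Lemma smooth_series_fraction S :
  series_fraction (smooth_series S) ((1 - q^-1) *: local_poly S) P.
Proof.
move=> k; have -> : P = 1%:P + (- q^-1) *: 'X by rewrite scaleNr.
rewrite coef_linear_sum mul1r coefZ /smooth_series /zero_density /local_poly.
have [s_odd|s_even] := boolP (odd #|S|).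
  rewrite coefB coef1 coefZ coefX.
  case: k => [|[|k]] /=; last first.
  - by rewrite exprS; field; rewrite ?expf_neq0 ?q_neq0.
  - by rewrite expr0; field; rewrite ?expf_neq0 ?q_neq0.
  - by field; rewrite ?expf_neq0 ?q_neq0.
rewrite coefCM coefD coef1 coefZ coefX.
(* For even rank everything is expressed in u = q^-(s/2), and the two values of the sign are checked
   separately. *)
have -> : q ^- #|S| = (q ^- #|S|./2) ^+ 2.
  by rewrite -!exprVn -exprM muln2 -[in LHS](odd_double_half #|S|) (negbTE s_even).
set u := q ^- _; have [->|->] := disc_signP S; case: k => [|[|k]] /=;
  by rewrite ?exprS ?expr0; field; rewrite ?expf_neq0 ?q_neq0.
Qed.

(** Over the residue field these are exactly the nondegenerate forms without nontrivial zero: in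
    rank 2 the signed discriminant has to be a nonsquare. *)
Definition anisotropic S : bool :=
  (#|S| <= 1)%N || (#|S| == 2) && (disc_sign S == -1).

(** The cofactor of 1 - t/q in [local_poly S] when [S] is anisotropic; the last branch is the value
    in rank 2. *)
Definition anisotropic_const S : rat :=
  match #|S| with 0 => 0 | 1 => 1 | _ => 1 + q^-1 end.

Lemma disc_sign0 S : #|S| = 0%N -> disc_sign S = 1.
Proof.
move=> /cards0_eq ->; rewrite /disc_sign cards0 big_set0 /sign_disc mul1r.
by rewrite quadratic_char1.
Qed.

Lemma local_poly_anisotropic S : anisotropic S ->
  local_poly S = P * (anisotropic_const S)%:P.
Proof.
rewrite /anisotropic /local_poly /anisotropic_const /linear_factor.
case s: #|S| => [|[|[|s']]]//=.
- by move=> _; rewrite disc_sign0// expr0 invr1 mulr1 subrr mul0r polyC0 mulr0.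
- by move=> _; rewrite expr1 polyC1 mulr1.
- move=> /eqP ->; rewrite expr1 -!mul_polyC !mulN1r !polyCN !polyCD !polyC1.
  by rewrite polyCN; ring.
Qed.

Lemma hornerP : P.[q] = 0.
Proof. by rewrite !hornerE mulVf// subrr. Qed.

Lemma expq_lt1 k : q ^- k.+1 < 1.
Proof. by rewrite -exprVn exprn_ilt1 ?invr_ge0 ?ler0n// invf_lt1// (lt_trans ltr01). Qed.

Lemma expq_gt0 k : 0 < q ^- k.
Proof. by rewrite -exprVn exprn_gt0// invr_gt0 (lt_trans ltr01). Qed.

Lemma qV_lt1 : q^-1 < 1.
Proof. by have := expq_lt1 0; rewrite expr1. Qed.

(** Odd rank gives 1 - q^(1-s) with s >= 3. Even rank gives (1 - eps u)(1 + eps u q), whose factors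
    are positive unless s = 0, or s = 2 and eps = -1. *)
Lemma local_poly_isotropic S : ~~ anisotropic S -> 0 < (local_poly S).[q].
Proof.
rewrite /anisotropic /local_poly.
have [|s_even] := boolP (odd #|S|).
  case: #|S| => [|[|[|s]]]//= _ _; rewrite !hornerE/=.
  by rewrite exprS invfM mulrC mulrA divff// mul1r subr_gt0 expq_lt1.
rewrite !hornerE.
have [->|->] := disc_signP S; case: #|S| s_even => [|[|[|[|s]]]]//= _ _.
- by rewrite expr1 mul1r mulVf// mulr_gt0// subr_gt0 qV_lt1.
- by rewrite mul1r mulr_gt0// ?subr_gt0 ?expq_lt1// ltr_wpDr// mulr_ge0 ?ltW ?expq_gt0.
- rewrite mulN1r opprK; apply: mulr_gt0; first by rewrite ltr_wpDr// ?ltW ?expq_gt0.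
  by rewrite exprS invfM mulNr mulrAC mulVf// mul1r subr_gt0 expq_lt1.
Qed.

Lemma local_poly_ge0 S : 0 <= (local_poly S).[q].
Proof.
have [/local_poly_anisotropic->|/local_poly_isotropic/ltW//] :=
  boolP (anisotropic S).
by rewrite hornerM hornerP mul0r.
Qed.

(** * The recursion on exponent functions *)

Variable J : {set 'I_n}.

Definition level e := [set i in J | e i == 0%N].
Definition even_part e := [set i in J | ~~ odd (e i)].
Definition odd_part e := [set i in J | odd (e i)].

(* Substituting pi x_i for the x_i with e i = 0 and dividing the form by pi. *)
Definition shift_exp e (i : 'I_n) : nat := if e i is k.+1 then k else 1.

(** The predicted volume of the set where pi^k divides the form, confirmed by [vol_div_density]. The
    first term comes from the smooth residues, the second from the points whose coordinates in the
    level are all divisible by pi. *)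
Fixpoint div_density (k : nat) e : rat :=
  if k is k'.+1 then
    q ^- k' * (zero_density (level e) - q ^- #|level e|)
    + q ^- #|level e| * div_density k' (shift_exp e)
  else 1.

Definition zeta_coef e (k : nat) : rat := div_density k e - div_density k.+1 e.

Lemma zeta_coef_rec e k :
  zeta_coef e k = smooth_series (level e) k
    + q ^- #|level e| * (if k is k'.+1 then zeta_coef (shift_exp e) k' else 0).
Proof.
rewrite /zeta_coef; case: k => [|k] /=; first by rewrite expr0 invr1; ring.
by rewrite exprS; field; rewrite ?expf_neq0 ?q_neq0.
Qed.

(** Agreement on [J] is what is available later: when the exponents on [J] are at most 1,
    [shift_exp] applied twice restores them there, but not necessarily elsewhere. *)
Lemma eq_div_density k e e' : {in J, e =1 e'} ->
  div_density k e = div_density k e'.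
Proof.
elim: k e e' => //= k IH e e' ee'.
have -> : level e = level e'.
  by apply/setP => i; rewrite !inE; case: (boolP (i \in J)) => //= /ee' ->.
by rewrite (IH _ (shift_exp e'))// => i /ee'; rewrite /shift_exp => ->.
Qed.

Lemma eq_zeta_coef e e' k : {in J, e =1 e'} -> zeta_coef e k = zeta_coef e' k.
Proof. by move=> ee'; rewrite /zeta_coef !(eq_div_density _ ee'). Qed.

Lemma even_part_shift e : even_part (shift_exp e) = odd_part e.
Proof.
by apply/setP => i; rewrite !inE /shift_exp; case: (e i) => //= k; rewrite ?negbK.
Qed.

Lemma odd_part_shift e : odd_part (shift_exp e) = even_part e.
Proof.
by apply/setP => i; rewrite !inE /shift_exp; case: (e i) => //= k; rewrite ?negbK.
Qed.

Lemma level_sub e : level e \subset even_part e.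
Proof. by apply/fintype.subsetP => i; rewrite !inE => /andP[-> /eqP ->]. Qed.

(** A proper subset of a two-element set has at most one element. In the induction on exponents this
    passes from the even part to the level. *)
Lemma anisotropic_sub S S' : S \subset S' -> anisotropic S' -> anisotropic S.
Proof.
move=> SS'; rewrite /anisotropic => /orP[s1|/andP[/eqP s2 e1]].
  by rewrite (leq_trans (subset_leq_card SS') s1).
have [->|NS] := eqVneq S S'; first by rewrite s2 e1.
have /proper_card : S \proper S' by rewrite finset.properEneq NS.
by rewrite s2 ltnS => ->.
Qed.

Lemma level_base e : {in J, forall i, (e i <= 1)%N} -> level e = even_part e.
Proof.
move=> e1; apply/setP => i; rewrite !inE.
by case: (boolP (i \in J)) => //= /e1; case: (e i) => [|[]].
Qed.

(** Two shifts restore the exponents on [J], so [e] and [shift_exp e] give a closed system of two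
    recursions, solved by [series_fraction_loop]. *)
Lemma zeta_coef_base e : {in J, forall i, (e i <= 1)%N} ->
  series_fraction (zeta_coef e)
    ((1 - q^-1) *: local_poly (even_part e)
     + q ^- #|even_part e| *: 'X * ((1 - q^-1) *: local_poly (odd_part e)))
    (P * (1 - (q ^- #|even_part e| * q ^- #|odd_part e|) *: 'X^2)).
Proof.
move=> e1.
have e1' : {in J, forall i, (shift_exp e i <= 1)%N}.
  by move=> i /e1; rewrite /shift_exp; case: (e i) => [|[]].
apply: series_fraction_loop.
- by move=> k; rewrite zeta_coef_rec (level_base e1).
- move=> k; rewrite zeta_coef_rec (level_base e1') even_part_shift.
  congr (_ + _ * _); case: k => // k; apply: eq_zeta_coef => i /e1.
  by rewrite /shift_exp; case: (e i) => [|[]].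
- exact: smooth_series_fraction.
- exact: smooth_series_fraction.
Qed.

(** * Lowest terms when all exponents are at most 1 *)

Definition anisotropic_denom S S' : {poly rat} :=
  if #|S| == #|S'| then 1 - q ^- #|S| *: 'X else 1 - q ^- (#|S| + #|S'|) *: 'X^2.

(** The expected denominator of the isotropic case without 1 - t/q. For two even ranks the product
    of the signs is the character of the signed total discriminant. *)
Definition isotropic_factor S S' : {poly rat} :=
  if odd #|S| && odd #|S'| then 1
  else if ~~ odd #|S| && ~~ odd #|S'| then
    1 - (disc_sign S * disc_sign S' * q ^- (#|S|./2 + #|S'|./2)) *: 'X
  else 1 - q ^- (#|S| + #|S'|) *: 'X^2.

Lemma anisotropic_denomC S S' : anisotropic_denom S S' = anisotropic_denom S' S.
Proof. by rewrite /anisotropic_denom eq_sym addnC; case: eqP => // ->. Qed.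

Lemma isotropic_factorC S S' : isotropic_factor S S' = isotropic_factor S' S.
Proof.
by rewrite /isotropic_factor andbC [~~ _ && _]andbC [disc_sign S * _]mulrC
  [(#|S| + _)%N]addnC [(#|S|./2 + _)%N]addnC.
Qed.

Lemma anisotropic_denom0 S S' : (anisotropic_denom S S').[0] = 1.
Proof. by rewrite /anisotropic_denom; case: ifP; rewrite !hornerE /= ?mulr0 ?subr0. Qed.

Lemma isotropic_factor0 S S' : (isotropic_factor S S').[0] = 1.
Proof.
by rewrite /isotropic_factor; do 2?[case: ifP => _]; rewrite !hornerE /= ?mulr0 ?subr0.
Qed.

Lemma linear_factor0 : P.[0] = 1.
Proof. by rewrite !hornerE. Qed.

Lemma coprimep_linear (a c : rat) (g : {poly rat}) : a != 0 \/ c != 0 ->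
  (c != 0 -> g.[- a / c] != 0) -> coprimep (a%:P + c *: 'X) g.
Proof.
move=> ac gN; have [c0|c0] := eqVneq c 0.
  case: ac; rewrite c0 ?eqxx// => a0.
  by rewrite scale0r addr0 -[a%:P]mulr1 mul_polyC coprimepZl// coprime1p.
have -> : a%:P + c *: 'X = c *: ('X - (- a / c)%:P).
  rewrite scalerBr -[c *: (_%:P)]mul_polyC -polyCM mulrCA divff// mulr1.
  by rewrite polyCN opprK addrC.
by rewrite coprimepZl// coprimep_sym coprimep_XsubC gN.
Qed.

(** A common root -a/c would satisfy c^2 = d a^2. The hypothesis also excludes a zero linear
    polynomial. *)
Lemma coprimep_linear_quadratic (a c d : rat) : c ^+ 2 != d * a ^+ 2 ->
  coprimep (a%:P + c *: 'X) (1 - d *: 'X^2).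
Proof.
move=> cda; apply: coprimep_linear => [|c0].
  have [a0|//] := eqVneq a 0; last by left.
  by move: cda; rewrite a0 expr0n mulr0 sqrf_eq0; right.
rewrite !horner_unitE; apply: contra cda => /eqP E.
have : c ^+ 2 * (1 - d * (- a / c) ^+ 2) = 0 by rewrite E mulr0.
have -> : c ^+ 2 * (1 - d * (- a / c) ^+ 2) = c ^+ 2 - d * a ^+ 2 by field.
by move/eqP; rewrite subr_eq0.
Qed.

(** Both local polynomials contain 1 - t/q, which cancels. Up to a constant this leaves cE +
    q^-r_even cO t over 1 - q^-r t^2. For equal ranks the constants agree and 1 + q^-r_even t
    cancels as well. *)
Lemma zeta_anisotropic_base e : {in J, forall i, (e i <= 1)%N} ->
  (0 < #|even_part e| + #|odd_part e|)%N ->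
  anisotropic (even_part e) -> anisotropic (odd_part e) ->
  exists2 f, series_fraction (zeta_coef e) f
      (anisotropic_denom (even_part e) (odd_part e))
    & coprimep f (anisotropic_denom (even_part e) (odd_part e)).
Proof.
move=> e1; have := zeta_coef_base e1.
set E := even_part e; set O := odd_part e => zE r_gt0 aE aO.
rewrite !local_poly_anisotropic// in zE.
set cE := anisotropic_const E in zE; set cO := anisotropic_const O in zE.
have q1 : 1 - q^-1 != 0 by rewrite subr_eq0 eq_sym lt_eqF// qV_lt1.
have {}zE : series_fraction (zeta_coef e)
  ((1 - q^-1) *: (cE%:P + (q ^- #|E| * cO) *: 'X))
  (1 - (q ^- #|E| * q ^- #|O|) *: 'X^2).
  apply: (@series_fraction_cancel _ _ _ _ P).
    by rewrite linear_factor0 oner_neq0.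
  rewrite (_ : P * _ = (1 - q^-1) *: (P * cE%:P)
    + q ^- #|E| *: 'X * ((1 - q^-1) *: (P * cO%:P)))//.
  by rewrite -!mul_polyC polyCM; ring.
rewrite -invfM -exprD in zE.
rewrite /anisotropic_denom; have [eo|eo] := eqVneq #|E| #|O|; last first.
  eexists; first exact: zE.
  rewrite coprimepZl//; apply: coprimep_linear_quadratic.
  (* With c_s the constant of rank s, the quantity q^s c_s^2 takes the distinct values 0, q and (q +
     1)^2 for s = 0, 1, 2. *)
  have : q ^+ #|O| * cO ^+ 2 != q ^+ #|E| * cE ^+ 2.
    move: aE aO eo; rewrite /anisotropic /cE /cO /anisotropic_const.
    have qq : q != (q + 1) ^+ 2 by rewrite lt_eqF//; have := q_gt1; nra.
    have q3 : (q + 1) ^+ 2 != 0 by rewrite sqrf_eq0 gt_eqF// addr_gt0// (lt_trans ltr01).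
    have E2 : q ^+ 2 * (1 + q^-1) ^+ 2 = (q + 1) ^+ 2 by field.
    case: #|E| => [|[|[|?]]]//=; case: #|O| => [|[|[|?]]]//= _ _ _;
      rewrite ?E2 ?expr0n ?expr1n /= ?mulr0 ?mulr1 ?expr1 //; by rewrite eq_sym.
  apply: contra => /eqP E1; apply/eqP.
  have : (q ^+ #|E| ^+ 2 * q ^+ #|O|) * (q ^- #|E| * cO) ^+ 2 =
      (q ^+ #|E| ^+ 2 * q ^+ #|O|) * (q ^- (#|E| + #|O|) * cE ^+ 2).
    by rewrite E1.
  have -> : (q ^+ #|E| ^+ 2 * q ^+ #|O|) * (q ^- #|E| * cO) ^+ 2 =
     q ^+ #|O| * cO ^+ 2 by field; rewrite ?expf_neq0 ?q_neq0.
  by move=> ->; rewrite exprD; field; rewrite ?expf_neq0 ?q_neq0.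
have co : cO = cE by rewrite /cO /cE /anisotropic_const eo.
(* Positive total rank excludes the constant 0, which belongs to rank 0. *)
have c0 : cE != 0.
  have qV : 0 < q^-1 by rewrite invr_gt0; apply: lt_trans q_gt1.
  have q1V : 1 + q^-1 != 0 by apply: lt0r_neq0; lra.
  move: r_gt0; rewrite /cE /anisotropic_const eo.
  by case: #|O| => [|[|?]] // _; rewrite ?oner_neq0.
exists ((1 - q^-1) *: cE%:P); last first.
  by rewrite coprimepZl// -[cE%:P]mulr1 mul_polyC coprimepZl// coprime1p.
apply: (@series_fraction_cancel _ _ _ _ (1 + q ^- #|E| *: 'X)).
  by rewrite !horner_unitE ?expr0n ?mulr0 ?addr0 ?subr0 oner_neq0.
move: zE; rewrite co -eo exprD invfM.
have -> : 1 - (q ^- #|E| / q ^+ #|E|) *: 'X^2 =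
   (1 + q ^- #|E| *: 'X) * (1 - q ^- #|E| *: 'X) :> {poly rat}.
  by rewrite -!mul_polyC polyCM; ring.
rewrite (_ : (1 - q^-1) *: (cE%:P + _) = (1 + q ^- #|E| *: 'X) * ((1 - q^-1) *: cE%:P))//.
by rewrite -!mul_polyC polyCM; ring.
Qed.

(** Modulo [h] the first polynomial is [c *: ('X - 1)], so only 1 could be a common root. Numerators
    are brought to this shape, [h] being the expected denominator. *)
Lemma coprimep_addX1 (h : {poly rat}) (c : rat) : h.[1] != 0 -> c != 0 ->
  coprimep (h + c *: ('X - 1)) h.
Proof.
move=> h1 c0; rewrite coprimep_sym -[X in X + _]mul1r coprimep_addl_mul.
by rewrite coprimepZr// -polyC1 coprimep_XsubC.
Qed.

Lemma coprimep_addXX1 (h : {poly rat}) (c : rat) : h.[0] != 0 -> h.[1] != 0 ->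
  c != 0 -> coprimep (h + c *: ('X * ('X - 1))) h.
Proof.
move=> h0 h1 c0; rewrite coprimep_sym -[X in X + _]mul1r coprimep_addl_mul.
rewrite coprimepZr// coprimepMr -polyC1 coprimep_XsubC h1 andbT.
by rewrite -['X]subr0 -polyC0 coprimep_XsubC.
Qed.

Lemma expq_half S : ~~ odd #|S| -> q ^- #|S| = q ^- #|S|./2 * q ^- #|S|./2.
Proof.
move=> s_even; rewrite -invfM -exprD addnn.
by rewrite -[in LHS](odd_double_half #|S|) (negbTE s_even).
Qed.

Lemma one_sub_quadratic_neq0 k : (0 < k)%N ->
  (1 - q ^- k *: 'X^2 : {poly rat}).[1] != 0.
Proof.
case: k => // k _; rewrite !horner_unitE. 
by rewrite expr1n mulr1 gt_eqF// subr_gt0 expq_lt1.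
Qed.

Lemma disc_sign_neq0 S : disc_sign S != 0.
Proof. by have [->|->] := disc_signP S; rewrite ?oppr_eq0 oner_neq0. Qed.

(** Positivity at q is included because it survives the induction on exponents and finally gives
    coprimality with 1 - t/q. *)
Lemma zeta_isotropic_base e : {in J, forall i, (e i <= 1)%N} ->
  ~~ (anisotropic (even_part e) && anisotropic (odd_part e)) ->
  exists f, [/\ series_fraction (zeta_coef e) f
      (P * isotropic_factor (even_part e) (odd_part e)),
    coprimep f (isotropic_factor (even_part e) (odd_part e)) & 0 < f.[q]].
Proof.
move=> e1; have := zeta_coef_base e1.
set E := even_part e; set O := odd_part e => zE iso.
have qV1 : 0 < 1 - q^-1 by rewrite subr_gt0 qV_lt1.
have q1 : 1 - q^-1 != 0 by rewrite gt_eqF.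
have {}zE : series_fraction (zeta_coef e)
  ((1 - q^-1) *: (local_poly E + q ^- #|E| *: 'X * local_poly O))
  (P * (1 - (q ^- #|E| * q ^- #|O|) *: 'X^2)).
  move: zE; congr (series_fraction _ _ _).
  by rewrite -!mul_polyC; ring.
(* Both local polynomials are nonnegative at q, and that of an isotropic part is positive. *)
have pos : 0 < (local_poly E + q ^- #|E| *: 'X * local_poly O).[q].
  rewrite !hornerE.
  have c0 : 0 < q ^- #|E| * q by rewrite mulr_gt0 ?expq_gt0// (lt_trans ltr01).
  move: iso; rewrite negb_and => /orP[] /local_poly_isotropic ?.
    by rewrite ltr_wpDr// mulr_ge0 ?local_poly_ge0// ltW.
  by rewrite ltr_wpDl// ?local_poly_ge0// mulr_gt0.
have r_gt0 : (0 < #|E| + #|O|)%N.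
  by move: iso; apply: contraR; rewrite -eqn0Ngt addn_eq0 => /andP[/eqP eE /eqP eO];
    rewrite /anisotropic eE eO.
rewrite /isotropic_factor; move: zE pos.
have [oE|oE] := boolP (odd #|E|); have [oO|oO] := boolP (odd #|O|) => /=.
(* For two odd ranks the numerator telescopes to 1 - q^-r t^2, which cancels. *)
- rewrite /local_poly oE oO => zE _; exists (1 - q^-1)%:P; split.
  + apply: (@series_fraction_cancel _ _ _ _ (1 - (q ^- #|E| * q ^- #|O|) *: 'X^2)).
      by rewrite !horner_unitE ?expr0n ?mulr0 ?addr0 ?subr0 oner_neq0.
    rewrite mulr1 mulrC mul_polyC [X in series_fraction _ _ X]mulrC.
    rewrite (_ : 1 - _ *: 'X^2 = (1 - q ^- #|E| *: 'X
      + q ^- #|E| *: 'X * (1 - q ^- #|O| *: 'X))) in zE *; first exact: zE.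
    by rewrite -!mul_polyC polyCM; ring.
  + exact: coprimep1.
  + by rewrite hornerC.
- rewrite -invfM -exprD => zE pos.
  exists ((1 - q^-1) *: (local_poly E + q ^- #|E| *: 'X * local_poly O)).
  split; [exact: zE| |by rewrite hornerZ mulr_gt0].
  rewrite coprimepZl// /local_poly oE (negbTE oO) /=.
  (* Expanding the factor of even rank leaves the denominator plus a multiple of t (t - 1). *)
  rewrite [X in coprimep X _](_ : _ = 1 - q ^- (#|E| + #|O|) *: 'X^2
    + (q ^- #|E| * disc_sign O * q ^- #|O|./2) *: ('X * ('X - 1))).
    rewrite coprimep_addXX1 ?one_sub_quadratic_neq0//.
      by rewrite !horner_unitE ?expr0n ?mulr0 ?addr0 ?subr0 oner_neq0.
    by rewrite !mulf_neq0 ?disc_sign_neq0// gt_eqF// expq_gt0.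
  rewrite exprD invfM (expq_half oO).
  by have [->|->] := disc_signP O;
    rewrite -!mul_polyC !polyCD !polyCN !polyCM ?polyCN !polyC1; ring.
- rewrite -invfM -exprD => zE pos.
  exists ((1 - q^-1) *: (local_poly E + q ^- #|E| *: 'X * local_poly O)).
  split; [exact: zE| |by rewrite hornerZ mulr_gt0].
  rewrite coprimepZl// /local_poly oO (negbTE oE) /=.
  (* The even-rank factor now comes without the extra t, so the remainder is a multiple of t - 1. *)
  rewrite [X in coprimep X _](_ : _ = 1 - q ^- (#|E| + #|O|) *: 'X^2
    + (disc_sign E * q ^- #|E|./2) *: ('X - 1)).
    rewrite coprimep_addX1 ?one_sub_quadratic_neq0//.
    by rewrite !mulf_neq0 ?disc_sign_neq0// gt_eqF// expq_gt0.
  rewrite exprD invfM (expq_half oE).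
  by have [->|->] := disc_signP E;
    rewrite -!mul_polyC !polyCD !polyCN !polyCM ?polyCN !polyC1; ring.
(* For two even ranks 1 - q^-r t^2 splits as (1 + c t)(1 - c t), where c is the product of both
   signs with [u * w]. The first factor [l] also divides the numerator. *)
- rewrite /local_poly (negbTE oO) (negbTE oE) /= (expq_half oE) (expq_half oO).
  rewrite exprD invfM; set u := q ^- _; set w := q ^- _.
  set c1 := disc_sign E; set c2 := disc_sign O => zE pos.
  have c12 : (c1 * c2) ^+ 2 = 1.
    by rewrite /c1 /c2; have [->|->] := disc_signP E; have [->|->] := disc_signP O; ring.
  (* The half ranks add up to at least 1; this keeps [l] nonnegative at q. *)
  have uw : u * w * q <= 1.
    rewrite /u /w -invfM -exprD.
    have : (0 < #|E|./2 + #|O|./2)%N.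
      by move: r_gt0 oE oO; case: #|E| => [|[|?]]//; case: #|O| => [|[|?]].
    case: (_ + _)%N => // k _; rewrite exprS invfM mulrC mulrA divff// mul1r.
    by case: k => [|k]; rewrite ?expr0 ?invr1// ltW// expq_lt1.
  have uw0 : 0 < u * w by rewrite mulr_gt0 ?expq_gt0.
  have uw1 : u * w < 1.
    by rewrite (lt_le_trans _ uw)// ltr_pMr.
  set f := (1 - q^-1) *: (1 - (c1 * c2 * (u * w)) *: 'X + (c1 * u) *: ('X - 1)).
  set l := 1 + (c1 * c2 * (u * w)) *: 'X.
  have fE : (1 - q^-1) *: ((1 - c1 * u)%:P * (1 + (c1 * u) *: 'X) +
       (u * u) *: 'X * ((1 - c2 * w)%:P * (1 + (c2 * w) *: 'X))) = l * f.
    rewrite /l /f /c1 /c2; have [->|->] := disc_signP E; have [->|->] := disc_signP O;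
    by rewrite -!mul_polyC !polyCD !polyCN !polyCM ?polyCN !polyC1; ring.
  have gE : P * (1 - (u * u * (w * w)) *: 'X^2) =
     l * (P * (1 - (c1 * c2 * (u * w)) *: 'X)).
    rewrite /l /f /c1 /c2; have [->|->] := disc_signP E; have [->|->] := disc_signP O;
    by rewrite -!mul_polyC !polyCM ?polyCN !polyC1; ring.
  have lq : 0 <= l.[q].
    rewrite /l horner_unitE.
    have : c1 * c2 = 1 \/ c1 * c2 = -1.
      by rewrite /c1 /c2; have [->|->] := disc_signP E; have [->|->] := disc_signP O;
        [left|right|right|left]; ring.
    have : 0 < u * w * q by rewrite mulr_gt0// (lt_trans ltr01).
    by move=> ? [->|->]; lra.
  exists f; split.
  + apply: (@series_fraction_cancel _ _ _ _ l).
      by rewrite /l !horner_unitE ?expr0n ?mulr0 ?addr0 ?subr0 oner_neq0.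
    by rewrite -fE -gE.
  + rewrite /f coprimepZl// coprimep_addX1//.
      rewrite !horner_unitE  mulr1.
      have : c1 * c2 = 1 \/ c1 * c2 = -1.
        by rewrite /c1 /c2; have [->|->] := disc_signP E; have [->|->] := disc_signP O;
          [left|right|right|left]; ring.
      by case=> ->; rewrite gt_eqF//; lra.
    by rewrite mulf_neq0 ?disc_sign_neq0// gt_eqF// expq_gt0.
  (* The product is positive at q and [l] is nonnegative there, so [f] is positive. *)
  + have : 0 < (l * f).[q] by rewrite -fE hornerZ mulr_gt0.
    by rewrite hornerM; move: lq; rewrite le_eqVlt => /orP[/eqP<-|lq];
      rewrite ?mul0r ?ltxx// pmulr_rgt0.
Qed.

(** * Lowest terms for arbitrary exponents *)

Lemma expq_div_le1 j k : (j <= k)%N -> q ^- k * q ^+ j <= 1.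
Proof.
move=> jk; rewrite mulrC ler_pdivrMr ?exprn_gt0 ?(lt_trans ltr01)// mul1r.
by rewrite ler_weXn2l// ltW.
Qed.

(** An isotropic part forces total rank r >= 2, so that q^-r q^2 and, for even ranks, q^-(r/2) q are
    at most 1. *)
Lemma isotropic_factor_ge0 S S' : ~~ (anisotropic S && anisotropic S') ->
  0 <= (isotropic_factor S S').[q].
Proof.
move=> iso; rewrite /isotropic_factor.
have r_gt1 : (1 < #|S| + #|S'|)%N.
  move: iso; apply: contraR; rewrite -leqNgt => rS.
  by rewrite /anisotropic !(leq_trans _ rS) ?leq_addl ?leq_addr.
have [oE|oE] := boolP (odd #|S|); have [oO|oO] := boolP (odd #|S'|) => /=.
- by rewrite hornerE.
- by rewrite horner_unitE subr_ge0 expq_div_le1//; lia.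
- by rewrite horner_unitE subr_ge0 expq_div_le1//; lia.
rewrite horner_unitE subr_ge0 -[_ * _ * q]mulrA; set x := _ * q.
have x1 : x <= 1 by have := @expq_div_le1 1 (#|S|./2 + #|S'|./2); rewrite expr1; apply; lia.
have x0 : 0 <= x by rewrite /x mulr_ge0// ?ltW ?expq_gt0.
by have [->|->] := disc_signP S; have [->|->] := disc_signP S'; lra.
Qed.

(** Induction on the exponent bound, which a shift lowers by one as long as it exceeds 1. Modulo the
    denominator [g] the new numerator is c t f, and [g] has constant term 1, so coprimality
    persists. *)
Lemma zeta_anisotropic M e : {in J, forall i, (e i <= M.+1)%N} ->
  (0 < #|even_part e| + #|odd_part e|)%N ->
  anisotropic (even_part e) -> anisotropic (odd_part e) ->
  exists2 f, series_fraction (zeta_coef e) f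
      (anisotropic_denom (even_part e) (odd_part e))
    & coprimep f (anisotropic_denom (even_part e) (odd_part e)).
Proof.
elim: M e => [|M IH] e eM r_gt0 aE aO; first exact: zeta_anisotropic_base.
have [||||f zf cf] := IH (shift_exp e).
- by move=> i /eM; rewrite /shift_exp; case: (e i).
- by rewrite even_part_shift odd_part_shift addnC.
- by rewrite even_part_shift.
- by rewrite odd_part_shift.
move: zf cf; rewrite even_part_shift odd_part_shift anisotropic_denomC.
set g := anisotropic_denom _ _ => zf cf.
have aS := anisotropic_sub (level_sub e) aE.
have zA := smooth_series_fraction (level e).
rewrite (local_poly_anisotropic aS) in zA.
set a := anisotropic_const _ in zA; set c := q ^- #|level e|.
exists (((1 - q^-1) * a) *: g + c *: 'X * f).
  apply: (@series_fraction_cancel _ _ _ _ P); first by rewrite linear_factor0 oner_neq0.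
  move: (series_fraction_recursion (zeta_coef_rec e) zA zf).
  congr (series_fraction _ _ _).
  by rewrite -!mul_polyC !polyCM; ring.
rewrite coprimep_sym -mul_polyC coprimep_addl_mul coprimepMr.
rewrite coprimepZr ?gt_eqF ?expq_gt0// [coprimep g f]coprimep_sym cf andbT.
by rewrite -['X]subr0 -polyC0 coprimep_XsubC /root anisotropic_denom0 oner_neq0.
Qed.

(** Again the new numerator is c t f modulo [h]. At q it is the sum of a nonnegative and a positive
    term, [h] being nonnegative there. *)
Lemma zeta_isotropic_aux M e : {in J, forall i, (e i <= M.+1)%N} ->
  ~~ (anisotropic (even_part e) && anisotropic (odd_part e)) ->
  exists f, [/\ series_fraction (zeta_coef e) f
      (P * isotropic_factor (even_part e) (odd_part e)),
    coprimep f (isotropic_factor (even_part e) (odd_part e)) & 0 < f.[q]].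
Proof.
elim: M e => [|M IH] e eM iso; first exact: zeta_isotropic_base.
have [||f [zf cf fq]] := IH (shift_exp e).
- by move=> i /eM; rewrite /shift_exp; case: (e i).
- by rewrite even_part_shift odd_part_shift andbC.
move: zf cf; rewrite even_part_shift odd_part_shift isotropic_factorC.
have := isotropic_factor_ge0 iso; have := isotropic_factor0 (even_part e) (odd_part e).
set h := isotropic_factor _ _ => h0 hq zf cf.
have zA := smooth_series_fraction (level e).
set c := q ^- #|level e|; set l := local_poly (level e) in zA.
exists ((1 - q^-1) *: l * h + c *: 'X * f); split.
- apply: (@series_fraction_cancel _ _ _ _ P); first by rewrite linear_factor0 oner_neq0.
  move: (series_fraction_recursion (zeta_coef_rec e) zA zf).
  congr (series_fraction _ _ _).
  by rewrite -!mul_polyC; ring.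
- rewrite coprimep_sym coprimep_addl_mul coprimepMr.
  rewrite coprimepZr ?gt_eqF ?expq_gt0// [coprimep h f]coprimep_sym cf andbT.
  by rewrite -['X]subr0 -polyC0 coprimep_XsubC /root h0 oner_neq0.
rewrite hornerD !hornerM !hornerZ hornerX ltr_wpDl//.
  by rewrite !mulr_ge0 ?local_poly_ge0// subr_ge0 ltW// qV_lt1.
by rewrite !mulr_gt0 ?expq_gt0// (lt_trans ltr01).
Qed.

Lemma zeta_isotropic M e : {in J, forall i, (e i <= M.+1)%N} ->
  ~~ (anisotropic (even_part e) && anisotropic (odd_part e)) ->
  exists2 f, series_fraction (zeta_coef e) f
      (P * isotropic_factor (even_part e) (odd_part e))
    & coprimep f (P * isotropic_factor (even_part e) (odd_part e)).
Proof.
move=> eM iso; have [f [zf cf fq]] := zeta_isotropic_aux eM iso.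
exists f => //; rewrite coprimepMr cf andbT.
have -> : P = (- q^-1) *: ('X - q%:P).
  rewrite scalerBr -[_ *: q%:P]mul_polyC -polyCM mulNr mulVf// polyCN polyC1.
  by rewrite opprK addrC scaleNr.
by rewrite coprimepZr ?oppr_eq0 ?invr_eq0// coprimep_XsubC /root gt_eqF.
Qed.

End DiagonalZeta.

(** * Divisibility by powers of the uniformizer, Hensel's lemma and square classes of units *)

Section PadicIntegers.
Variables (p : nat) (K : padicField p).
Local Notation R := (valuationRing K).
Local Notation F := (residueField K).
Local Notation res := (residue K).
Local Notation v := (@valuation K).
Variable pi : R.
Hypothesis pi_unif : uniformizer pi.
Implicit Types (a b x : R) (k j : nat).

Definition vge k a : bool := (k%:Z%:E <= vpi a)%E.

Lemma vpiM a b : vpi (a * b) = (vpi a + vpi b)%E.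
Proof. exact: valuationM. Qed.

Lemma vpi_piX k : vpi (pi ^+ k) = k%:Z%:E.
Proof.
elim: k => [|k IH]; first by rewrite expr0 /vpi /= valuation1.
by rewrite exprS vpiM IH pi_unif -EFinD; congr EFin; lia.
Qed.

Lemma pi_neq0 : pi != 0.
Proof.
apply/eqP => pi0; move: pi_unif; rewrite pi0 /uniformizer /vpi /=.
by rewrite valuation0.
Qed.

Lemma piX_neq0 k : pi ^+ k != 0.
Proof. by rewrite expf_neq0// pi_neq0. Qed.

Lemma vpi_ge0 a : (0 <= vpi a)%E.
Proof. exact: ivalP. Qed.

Lemma vge0 a : vge 0 a.
Proof. exact: vpi_ge0. Qed.

Lemma vgeP k a : reflect (exists b, a = pi ^+ k * b) (vge k a).
Proof.
apply: (iffP idP) => [ka|[b ->]]; last first.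
  by rewrite /vge vpiM vpi_piX leeDl// vpi_ge0.
have [->|a0] := eqVneq a 0; first by exists 0; rewrite mulr0.
have piK : ival (pi ^+ k) != 0.
  by have := piX_neq0 k; rewrite -(inj_eq val_inj).
have bP : ival a / ival (pi ^+ k) \in @Defs.integral K.
  rewrite unfold_in valuationM.
  have := valuationV piK; have [j vj] := valuation_fin (invr_neq0 piK).
  have := vpi_piX k; rewrite /vpi => ->; rewrite vj -EFinD => -[] kj.
  move: ka; rewrite /vge /vpi; case: (v (ival a)) => [i| |]//.
  rewrite lee_fin -EFinD lee_fin => ki.
  by rewrite -kj lerD2r.
exists (Integral bP); apply: val_inj => /=.
by rewrite mulrC divfK.
Qed.

Lemma vgeD k a b : vge k a -> vge k b -> vge k (a + b).
Proof. by move=> /vgeP[c ->] /vgeP[d ->]; apply/vgeP; exists (c + d); rewrite mulrDr. Qed.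

Lemma vgeN k a : vge k (- a) = vge k a.
Proof. by rewrite /vge /vpi /= valuationN. Qed.

Lemma vgeB k a b : vge k a -> vge k b -> vge k (a - b).
Proof. by move=> ka kb; rewrite vgeD// vgeN. Qed.

Lemma vgeMl k a b : vge k a -> vge k (b * a).
Proof. by move=> /vgeP[c ->]; apply/vgeP; exists (b * c); rewrite mulrCA. Qed.

Lemma vgeMr k a b : vge k a -> vge k (a * b).
Proof. by move=> ka; rewrite mulrC vgeMl. Qed.

Lemma vge_piX k a : vge k (pi ^+ k * a).
Proof. by apply/vgeP; exists a. Qed.

Lemma vge_piXM j k a : vge (j + k) (pi ^+ j * a) = vge k a.
Proof.
apply/vgeP/vgeP => [[b]|[b ->]]; last by exists b; rewrite exprD mulrA.
by rewrite exprD -mulrA => /(mulfI (piX_neq0 j)) ->; exists b.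
Qed.

Lemma vge_addr k a b : vge k b -> vge k (a + b) = vge k a.
Proof.
move=> kb; apply/idP/idP => ka; last exact: vgeD.
by rewrite -(addrK b a) vgeB.
Qed.

Lemma vge_leq j k a : (j <= k)%N -> vge k a -> vge j a.
Proof. by move=> jk; apply: le_trans; rewrite lee_fin lez_nat. Qed.

Lemma vge_eq0 a : (forall k, vge k a) -> a = 0.
Proof.
move=> ka; apply/eqP; case: (eqVneq a 0) => // a0.
have a1 : ival a != 0 by have := a0; rewrite -(inj_eq val_inj).
have [j vj] := valuation_fin a1; have := ka `|j|.+1%N; rewrite /vge /vpi vj lee_fin.
by lia.
Qed.

Lemma vpi_eqP a k : vpi a = k%:Z%:E <-> vge k a && ~~ vge k.+1 a.
Proof.
rewrite /vge; case: (vpi a) => [i| |].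
- rewrite !lee_fin; split=> [[->]|]; first by lia.
  by move=> ?; congr EFin; lia.
- by rewrite !leey.
- by rewrite leeNy_eq.
Qed.

Lemma residue_vge a : (res a == 0) = vge 1 a.
Proof.
apply/eqP/idP => [/residue_eq0|a1]; last first.
  by apply/residue_eq0; apply: lt_le_trans a1; rewrite lte_fin.
by rewrite /vge /vpi; case: (v (ival a)) => [i| |]//; rewrite ?leey// lte_fin lee_fin; lia.
Qed.

Lemma residue_pi : res pi = 0.
Proof. by apply/eqP; rewrite residue_vge -[pi]mulr1 -[X in X * _]expr1 vge_piX. Qed.

Lemma unit_residue a : (a \is a GRing.unit) = (res a != 0).
Proof.
rewrite residue_vge; change ((vpi a == 0%E) = ~~ vge 1 a).
apply/eqP/idP => [/(vpi_eqP a 0)/andP[]//|a1].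
by apply/(vpi_eqP a 0); rewrite vge0.
Qed.

Lemma res_lift : exists s : F -> R, forall c, res (s c) = c.
Proof. by have [s sP] := choice (@residue_surj p K); exists s. Qed.

Hypothesis p_odd : odd p.

Lemma res_two_neq0 : (2 : F) != 0.
Proof.
have /andP[p_prime /eqP p0] := residue_pchar K.
apply/eqP => two0.
have odd1 m : odd m -> (m%:R : F) = 1.
  move=> om; rewrite -(odd_double_half m) om natrD -mul2n natrM two0 mul0r.
  by rewrite addr0.
by have := oner_neq0 F; rewrite -(odd1 p p_odd) p0 eqxx.
Qed.

Lemma unit_two : (2 : R) \is a GRing.unit.
Proof. by rewrite unit_residue rmorph_nat res_two_neq0. Qed.

(** Newton iteration for x^2 = b, started at a lift of [c]. As 2 and the iterates are units, each
    step gains a power of pi in the error, and completeness provides the limit. *)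
Lemma hensel_sqr b c : b \is a GRing.unit -> res b = c ^+ 2 -> unit_square b.
Proof.
move=> ub bc; have [s sK] := res_lift.
pose u := fix u k := if k is k'.+1 then u k' - (u k' ^+ 2 - b) / (2 * u k') else s c.
have c0 : c != 0 by apply: contraTneq ub => c0; rewrite unit_residue bc c0 expr0n eqxx.
have uP k : vge k.+1 (u k ^+ 2 - b) && (res (u k) != 0).
  elim: k => [|k /andP[IH ru]].
    by rewrite -residue_vge /= rmorphB rmorphXn /= sK bc subrr eqxx.
  have u2 : 2 * u k \is a GRing.unit by rewrite unitrM unit_two unit_residue.
  rewrite -[u k.+1]/(u k - (u k ^+ 2 - b) / (2 * u k)).
  set t := (u k ^+ 2 - b) / (2 * u k).
  have kt : vge k.+1 t by rewrite vgeMr.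
  (* The correction cancels the error to first order, so the new error is exactly its square. *)
  have -> : (u k - t) ^+ 2 - b = t ^+ 2.
    have tE : u k ^+ 2 - b = t * (2 * u k) by rewrite /t divrK.
    have -> : (u k - t) ^+ 2 - b = (u k ^+ 2 - b) - t * (2 * u k) + t ^+ 2 by ring.
    by rewrite tE subrr add0r.
  have rt : res t = 0 by apply/eqP; rewrite residue_vge (vge_leq _ kt).
  rewrite rmorphB /= rt subr0 ru andbT.
  case/vgeP: kt => w ->; apply/vgeP; exists (pi ^+ k * w ^+ 2).
  by rewrite !exprS expr0; ring.
have step k : vge k.+1 (u k.+1 - u k).
  have /andP[kb _] := uP k.
  by rewrite /= addrC addKr vgeN vgeMr.
have cau k i : (k <= i)%N -> vge k.+1 (u i - u k).
  elim: i => [|i IH]; first by rewrite leqn0 => /eqP ->; rewrite subrr -(mulr0 (pi ^+ 1)) vge_piX.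
  rewrite leq_eqVlt => /orP[/eqP ->|]; first by rewrite subrr -(mulr0 (pi ^+ i.+2)) vge_piX.
  rewrite ltnS => ki; have -> : u i.+1 - u k = (u i.+1 - u i) + (u i - u k).
    by rewrite addrA subrK.
  by rewrite vgeD ?IH// (vge_leq _ (step i)).
have vgeK (e : int) a : vge `|e|%N a -> (e%:E <= vpi a)%E.
  by apply: le_trans; rewrite lee_fin; lia.
have [|l lP] := @padic_complete p K (fun k => ival (u k)).
  move=> e; exists `|e|%N => i j ei ej.
  apply: (vgeK e (u i - u j)); have -> : u i - u j = (u i - u `|e|%N) - (u j - u `|e|%N).
    by rewrite opprB addrA subrK.
  by apply: vgeB; apply: vge_leq (cau _ _ _).
(* An approximation with integral error already shows that the limit is integral. *)
have lI : l \in @Defs.integral K.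
  have [k /(_ k (leqnn k)) kl] := lP 0.
  rewrite unfold_in -[l](subKr (ival (u k))).
  apply: le_trans (valuationD _ _); rewrite valuationN le_min.
  by rewrite kl andbT; exact: vpi_ge0.
pose L : R := Integral lI.
have LP k : exists i, (k <= i)%N /\ vge k (u i - L).
  have [j jP] := lP k%:Z; exists (maxn k j); split; first exact: leq_maxl.
  exact: (jP _ (leq_maxr k j)).
have L2 : L ^+ 2 = b.
  apply/eqP; rewrite -subr_eq0; apply/eqP/vge_eq0 => k.
  have [i [ki kL]] := LP k; have /andP[iu _] := uP i.
  have -> : L ^+ 2 - b = (u i ^+ 2 - b) - (u i - L) * (u i + L) by ring.
  by rewrite vgeB ?vgeMr// (vge_leq _ iu)// ltnW.
exists L; last by rewrite L2.
by move: ub; rewrite -L2 unitrX_pos.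
Qed.

Lemma unit_squareP b : b \is a GRing.unit ->
  unit_square b <-> exists x : F, x ^+ 2 = res b.
Proof.
move=> ub; split=> [[u _ ->]|[x /esym]]; last exact: hensel_sqr.
by exists (res u); rewrite rmorphXn.
Qed.

Lemma unit_etaE b : b \is a GRing.unit -> unit_eta b = quadratic_char (res b).
Proof.
move=> ub; have r0 : res b != 0 by rewrite -unit_residue.
rewrite /unit_eta; case: asboolP => [/(unit_squareP ub)[x xb]|bN].
  rewrite -xb quadratic_char_sqr// ?res_two_neq0//.
  by apply: contraNneq r0 => x0; rewrite -xb x0 expr0n.
rewrite quadratic_char_nonsqr// => x; apply/eqP => xb.
by apply: bN; apply/(unit_squareP ub); exists x.
Qed.

Lemma quadratic_char_same_class a b : b \is a GRing.unit -> same_class a b ->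
  quadratic_char (res a) = quadratic_char (res b).
Proof.
move=> ub [u uu ->]; rewrite rmorphM rmorphXn mulrC quadratic_char_sqrM//.
by rewrite -unit_residue.
Qed.

(** The residue of the quotient of the two units has character 1, so the quotient is a square by
    Hensel's lemma. *)
Lemma same_class_quadratic_char a b : a \is a GRing.unit -> b \is a GRing.unit ->
  quadratic_char (res a) = quadratic_char (res b) -> same_class a b.
Proof.
move=> ua ub ab; have : unit_square (a / b).
  apply/unit_squareP; first by rewrite unitrM ua unitrV.
  have rb : res b != 0 by rewrite -unit_residue.
  have : quadratic_char (res (a / b)) = 1.
    have -> : res (a / b) = (res b)^-1 ^+ 2 * (res a * res b).
      by rewrite rmorphM rmorphV//=; field.
    rewrite quadratic_char_sqrM ?invr_eq0// quadratic_charM ?res_two_neq0// ab.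
    by rewrite -expr2 quadratic_char_sqr1 ?res_two_neq0.
  case: (quadratic_charP res_two_neq0 (res (a / b))) => // x x0 -> _.
  by exists x.
by move=> [u uu abu]; exists u => //; rewrite -abu mulrC divrK.
Qed.

End PadicIntegers.

(** * Diagonalization of unimodular forms and of Jordan decompositions *)

Lemma mul_mxdiag_mxdiag (S : pzSemiRingType) (N : nat) (r : 'I_N -> nat)
    (A B : forall i, 'M[S]_(r i)) :
  \mxdiag_i A i *m \mxdiag_i B i = \mxdiag_i (A i *m B i).
Proof.
rewrite [X in _ *m X]/mxdiag mul_mxdiag_mxblock; apply: eq_mxblock => i j.
by case: eqVneq => [->|_]; rewrite ?conform_mx_id ?mulmx0.
Qed.

Section Diagonalization.
Variables (p : nat) (K : padicField p).
Local Notation R := (valuationRing K).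
Local Notation res := (residue K).
Hypothesis p_odd : odd p.
Variable pi : R.

(** Some entry is a unit, as the determinant is nonzero modulo pi. If the diagonal entries at its
    two indices are not units, the value at e_i + e_j is one, since 2 is a unit. The coordinate
    equal to 1 serves to complete [w] to a basis. *)
Lemma unit_value n (M : 'M[R]_n.+1) : M^T = M -> \det M \is a GRing.unit ->
  exists (w : 'cV[R]_n.+1) i, w i 0 = 1 /\ qform M w \is a GRing.unit.
Proof.
move=> Msym uM.
have [i [j rM]] : exists i j, res (M i j) != 0.
  apply: contrapT => /forallNP MN; move: uM; rewrite unit_residue -det_map_mx.
  rewrite (_ : map_mx _ M = 0) ?det0 ?eqxx//.
  apply/matrixP => i j; rewrite !mxE; apply/eqP/negPn/negP => Mij.
  by case: (MN i); exists j.
have Qdelta k l : ((delta_mx k 0 : 'cV[R]_n.+1)^T *m M *m (delta_mx l 0 : 'cV[R]_n.+1)) 0 0 = M k l.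
  by rewrite trmx_delta -rowE -colE !mxE.
have [uii|Nii] := boolP (M i i \is a GRing.unit).
  by exists (delta_mx i 0), i; rewrite mxE !eqxx /qform Qdelta.
have [ujj|Njj] := boolP (M j j \is a GRing.unit).
  by exists (delta_mx j 0), j; rewrite mxE !eqxx /qform Qdelta.
have ij : i != j by apply: contraNneq Nii => ij; rewrite unit_residue {2}ij.
exists (delta_mx i 0 + delta_mx j 0), i; split.
  by rewrite !mxE !eqxx (negbTE ij) addr0.
have -> : qform M (delta_mx i 0 + delta_mx j 0) = M i i + M j j + 2 * M i j.
  rewrite /qform [(_ + _)^T]linearD /= mulmxDl mulmxDr !mulmxDl.
  rewrite mxE [X in X + _]mxE [X in _ + X]mxE !Qdelta.
  have -> : M j i = M i j by rewrite -[in LHS]Msym mxE.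
  by ring.
move: Nii Njj; rewrite !unit_residue !negbK => /eqP Nii /eqP Njj.
rewrite !rmorphD rmorphM /= Nii Njj !add0r rmorph_nat mulf_neq0//.
exact: res_two_neq0.
Qed.

Lemma unit_corner n (M : 'M[R]_n.+1) : M^T = M -> \det M \is a GRing.unit ->
  exists2 W : 'M[R]_n.+1, W \in unitmx & (W^T *m M *m W) 0 0 \is a GRing.unit.
Proof.
move=> Msym uM; have [w [i [wi uw]]] := unit_value Msym uM.
(* Adding [A] to the identity replaces the basis vector of index [i] by [w]. As [w i 0 = 1], [A]
   squares to zero and 1 + A has inverse 1 - A. *)
pose A : 'M[R]_n.+1 := (w - delta_mx i 0) *m delta_mx 0 i.
have AA : A *m A = 0.
  rewrite /A mulmxA -[X in X *m _]mulmxA -rowE.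
  rewrite (_ : row i _ = 0) ?mulmx0 ?mul0mx//.
  by apply/matrixP => k l; rewrite !ord1 !mxE wi !eqxx subrr.
have uA : 1%:M + A \in unitmx.
  have [] // : 1%:M + A \in unitmx /\ 1%:M - A \in unitmx.
  by apply: mulmx1_unit; rewrite mulmxDl mul1mx mulmxBr mulmx1 AA subr0 subrK.
have Ai : col i (1%:M + A) = w.
  rewrite colE mulmxDl mul1mx /A -mulmxA mul_delta_mx.
  have -> : delta_mx 0 0 = 1%:M :> 'M[R]_1 by apply/matrixP => k l; rewrite !ord1 !mxE.
  by rewrite mulmx1 addrC subrK.
exists ((1%:M + A) *m tperm_mx i 0).
  by rewrite unitmx_mul uA unitmx_perm.
have -> : forall B C : 'M[R]_n.+1, (C^T *m B *m C) 0 0 = qform B (col 0 C).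
  move=> B C; rewrite /qform [LHS]mxE [RHS]mxE.
  by apply: eq_bigr => k _; rewrite !mxE; congr (_ * _); apply: eq_bigr => l _; rewrite !mxE.
rewrite (_ : col 0 _ = w)//.
rewrite -[RHS]Ai; apply/matrixP => k l.
by rewrite -xcolE !mxE perm.tpermR.
Qed.

Definition diagonalizable n (M : 'M[R]_n) :=
  exists (W : 'M[R]_n) (d : 'rV[R]_n),
    W \in unitmx /\ W^T *m M *m W = diag_mx d.

(** Completing the square: [W2] clears the row and column of the unit corner, leaving the Schur
    complement [C'] to the induction hypothesis. *)
Lemma diagonalizable_corner n (M : 'M[R]_(1 + n)) :
  M^T = M -> \det M \is a GRing.unit ->
  M (lshift n 0) (lshift n 0) \is a GRing.unit ->
  (forall C : 'M[R]_n, C^T = C -> \det C \is a GRing.unit -> diagonalizable C) ->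
  diagonalizable M.
Proof.
move=> Msym uM; set a := M _ _ => u0 IH.
pose u := ursubmx M; pose C := drsubmx M.
have ME : M = block_mx a%:M u u^T C.
  rewrite -[LHS]submxK; congr (block_mx _ _ _ _).
    by apply/matrixP => i j; rewrite !ord1 !mxE /= mulr1n.
  by rewrite trmx_ursub Msym.
pose W2 : 'M[R]_(1 + n) := block_mx 1%:M (- a^-1 *: u) 0 1%:M.
pose C' := C - a^-1 *: (u^T *m u).
have W2E : W2^T *m M *m W2 = block_mx a%:M 0 0 C'.
  rewrite ME /W2 tr_block_mx !trmx1 trmx0 !mulmx_block.
  rewrite !(mul1mx, mulmx1, mul0mx, mulmx0, addr0, add0r) -scalemxAr.
  have -> : - a^-1 *: (a%:M *m u) + u = 0.
    by rewrite mul_scalar_mx scalerA mulNr mulVr// scaleN1r addNr.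
  have -> : (- a^-1 *: u)^T = - a^-1 *: u^T by rewrite linearZ.
  rewrite mul_mx_scalar scalerA mulrN divrr// scaleN1r addNr mul0mx add0r.
  by rewrite -scalemxAl scaleNr addrC.
have Csym : C'^T = C'.
  have : (W2^T *m M *m W2)^T = W2^T *m M *m W2.
    by rewrite !trmx_mul trmxK Msym mulmxA.
  by rewrite W2E tr_block_mx => /eq_block_mx[_ _ _].
have uW2 : W2 \in unitmx by rewrite unitmxE det_ublock !det1 mulr1 unitr1.
have uC : \det C' \is a GRing.unit.
  have : \det (W2^T *m M *m W2) \is a GRing.unit.
    by rewrite !det_mulmx det_tr !unitrM -!unitmxE uW2 unitmxE uM.
  by rewrite W2E det_ublock unitrM => /andP[].
have [W' [d [uW' W'E]]] := IH C' Csym uC.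
pose W3 : 'M[R]_(1 + n) := block_mx 1%:M 0 0 W'.
exists (W2 *m W3), (row_mx a%:M d); split.
  by rewrite unitmx_mul uW2 /= unitmxE det_ublock det1 mul1r -unitmxE.
rewrite trmx_mul !mulmxA.
have -> : W3^T *m W2^T *m M *m W2 *m W3 =
   W3^T *m (W2^T *m M *m W2) *m W3 by rewrite !mulmxA.
rewrite W2E /W3 tr_block_mx !trmx1 !trmx0 !mulmx_block.
rewrite !(mul1mx, mulmx1, mul0mx, mulmx0, addr0, add0r) W'E.
rewrite diag_mx_row; congr (block_mx _ _ _ _); apply/matrixP => i j.
by rewrite !ord1 !mxE eqxx.
Qed.

Lemma unimodular_diagonalizable n (M : 'M[R]_n) : unimodular M ->
  diagonalizable M.
Proof.
elim: n M => [|n IH] M [Msym uM].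
  by exists 1%:M, 0; split; [exact: unitmx1|apply/matrixP => -[]].
have [W0 uW0 u0] := unit_corner Msym uM.
have [||||W [d [uW WE]]] := @diagonalizable_corner n (W0^T *m M *m W0).
- by rewrite !trmx_mul trmxK Msym mulmxA.
- by rewrite !det_mulmx det_tr !unitrM uM -unitmxE uW0.
- by rewrite (_ : lshift n 0 = 0)//; apply: val_inj.
- by move=> C sC uC; apply: IH.
exists (W0 *m W), d; split; first by rewrite unitmx_mul uW0.
by rewrite -WE trmx_mul !mulmxA.
Qed.

Definition diag_form n (J : {set 'I_n}) (e : 'I_n -> nat) (a : 'I_n -> R)
    (x : 'cV[R]_n) : R :=
  \sum_(i in J) pi ^+ e i * a i * x i 0 ^+ 2.

(** [J] consists of the variables outside the final zero block. The last clause takes any predicate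
    on exponents, so that even, odd and total parts are all instances. *)
Lemma jordan_diagonal (rk : nat -> nat) (Qs : forall i, 'M[R]_(rk i)) (N m : nat) :
  (forall i, unimodular (Qs i)) ->
  let n := (\sum_(i < N) rk i + m)%N in
  exists (W : 'M[R]_n) (J : {set 'I_n}) (e : 'I_n -> nat) (a : 'I_n -> R),
  [/\ W \in unitmx, forall i, a i \is a GRing.unit,
    forall i, (e i <= N)%N,
    forall x, qform (jordan_form pi Qs N m) (W *m x) = diag_form J e a x &
    forall P : pred nat,
      #|[set i in J | P (e i)]| = (\sum_(k < N | P k) rk k)%N /\
      same_class (\prod_(i in [set i in J | P (e i)]) a i)
                 (\prod_(k < N | P k) \det (Qs k))].
Proof.
move=> Qu n.
have WP i : {Wd : 'M[R]_(rk i) * 'rV[R]_(rk i) |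
    Wd.1 \in unitmx /\ Wd.1^T *m Qs i *m Wd.1 = diag_mx Wd.2}.
  by apply: cid; have [W [d]] := unimodular_diagonalizable (Qu i); exists (W, d).
pose W0 i := (sval (WP i)).1; pose d i := (sval (WP i)).2.
have uW0 i : W0 i \in unitmx by have [] := svalP (WP i).
have W0E i : (W0 i)^T *m Qs i *m W0 i = diag_mx (d i) by have [] := svalP (WP i).
have dE i : \prod_(j < rk i) d i 0 j = \det (Qs i) * \det (W0 i) ^+ 2.
  by rewrite -det_diag -W0E !det_mulmx det_tr; ring.
have ud i j : d i 0 j \is a GRing.unit.
  have : \prod_(j < rk i) d i 0 j \is a GRing.unit.
    by rewrite dE unitrM unitrX ?andbT -?unitmxE//; have [] := Qu i.
  by rewrite (bigD1 j)//= unitrM => /andP[].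
pose W : 'M[R]_n := block_mx (\mxdiag_(i < N) W0 i) 0 0 1%:M.
(* On the zero block, [e] and [a] take the default values 0 and 1; the latter keeps every [a i] a
   unit. *)
pose e (x : 'I_n) : nat :=
  if fintype.split x is inl y then tagnat.sig1 y : nat else 0%N.
pose a (x : 'I_n) : R :=
  if fintype.split x is inl y then d (tagnat.sig1 y) 0 (tagnat.sig2 y) else 1.
pose J : {set 'I_n} := [set x | if fintype.split x is inl _ then true else false]%SET.
exists W, J, e, a; split.
- pose W' : 'M[R]_n := block_mx (\mxdiag_(i < N) invmx (W0 i)) 0 0 1%:M.
  suff /mulmx1_unit[] : W *m W' = 1%:M by [].
  rewrite mulmx_block !(mulmx0, mul0mx, addr0, add0r, mulmx1).
  rewrite mul_mxdiag_mxdiag (eq_mxdiag (B'_ := fun i => 1%:M)) ?mxdiagZ.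
    by rewrite -scalar_mx_block.
  by move=> i; rewrite mulmxV.
- by move=> i; rewrite /a; case: (fintype.split i) => // _; rewrite unitr1.
- by move=> i; rewrite /e; case: (fintype.split i) => // y; rewrite ltnW.
- move=> x; rewrite /qform trmx_mul !mulmxA.
  have -> : x^T *m W^T *m jordan_form pi Qs N m *m W *m x =
     x^T *m (W^T *m jordan_form pi Qs N m *m W) *m x by rewrite !mulmxA.
  have -> : W^T *m jordan_form pi Qs N m *m W =
     diag_mx (row_mx (\mxrow_(i < N) (pi ^+ i *: d i)) 0).
    rewrite diag_mx_row diag_mxrow /jordan_form /W tr_block_mx !trmx0 !mulmx_block.
    rewrite !(mulmx0, mul0mx, addr0, add0r) tr_mxdiag !mul_mxdiag_mxdiag.
    congr block_mx; last by apply/matrixP => i j; rewrite !mxE mul0rn.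
    by apply: eq_mxdiag => i; rewrite -scalemxAr -scalemxAl W0E linearZ.
  rewrite mul_mx_diag mxE /diag_form [RHS]big_mkcond /=.
  apply: eq_bigr => i _; rewrite !mxE inE /e /a.
  case: (fintype.split i) => y; rewrite !mxE; last by rewrite mulr0 mul0r.
  by ring.
move=> P.
(* One reindexing by blocks, in any commutative monoid, serves both the rank count and the product
   of coefficients. *)
have bigE (S : Type) (idx : S) (op : Monoid.com_law idx) (f : 'I_n -> S)
    (g : forall k, 'I_(rk k) -> S) :
    (forall y : 'I_(\sum_(i < N) rk i), f (lshift m y) = g (tagnat.sig1 y) (tagnat.sig2 y)) ->
    \big[op/idx]_(i in [set i in J | P (e i)]) f i =
    \big[op/idx]_(k < N | P k) \big[op/idx]_(j < rk k) g k j.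
  move=> fg; rewrite big_split_ord /= [X in op _ X]big1 ?Monoid.mulm1; last first.
    move=> i; rewrite !inE /=; case: (fintype.splitP (rshift _ i)) => // y /= yE.
    by have := ltn_ord y; rewrite -yE; lia.
  rewrite sig_big_dep (reindex _ (onW_bij _ (Bijective (@tagnat.sigK _ _) (@tagnat.rankK _ _))))/=.
  apply: eq_big => [y|y _]; last exact: fg.
  by rewrite !inE /e (unsplitK (inl y)) andbT.
have lsE y : fintype.split (lshift m y : 'I_n) = inl y by rewrite (unsplitK (inl y)).
split.
  rewrite -sum1_card (bigE _ _ _ _ (fun _ _ => 1%N))//.
  by apply: eq_bigr => k _; rewrite sum1_card card_ord.
exists (\prod_(k < N | P k) \det (W0 k)).
  by rewrite unitr_prod// => k _; rewrite -unitmxE.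
rewrite (bigE _ _ _ _ (fun k j => d k 0 j)); last by move=> y; rewrite /a lsE.
by under eq_bigr => k _ do rewrite dE; rewrite big_split /= prodrXl.
Qed.

End Diagonalization.

(** * Haar volume of cylinder sets and uniqueness of invariant contents *)

Section Volume.
Variables (p : nat) (K : padicField p).
Local Notation R := (valuationRing K).
Local Notation F := (residueField K).
Local Notation res := (residue K).
Variable pi : R.
Hypothesis pi_unif : uniformizer pi.
Variables (T : realType) (n : nat) (mu : {measure set (Rn K n) -> \bar T}).
Hypothesis mu_haar : normalized_haar mu.
Local Notation V := 'cV[R]_n.
Local Notation W := 'cV[F]_n.
Implicit Types (A B : set V) (x y z : V) (c : W) (k j : nat).

(** Such a set is a union of cosets of pi^k R^n, that is, a condition on x modulo pi^k. *)
Definition periodic k A := forall x z, A x -> A (x + pi ^+ k *: z).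
Definition cylinder A := exists k, periodic k A.

Lemma periodic_leq k j A : (k <= j)%N -> periodic k A -> periodic j A.
Proof.
by move=> /subnKC <- kA x z Ax; rewrite exprD -scalerA; apply: kA.
Qed.

Lemma cylinderI A B : cylinder A -> cylinder B -> cylinder (A `&` B).
Proof.
move=> [k kA] [j jB]; exists (maxn k j) => x z [Ax Bx]; split.
  exact: (periodic_leq (leq_maxl k j) kA).
exact: (periodic_leq (leq_maxr k j) jB).
Qed.

Lemma cylinderU A B : cylinder A -> cylinder B -> cylinder (A `|` B).
Proof.
move=> [k kA] [j jB]; exists (maxn k j) => x z [Ax|Bx]; [left|right].
  exact: (periodic_leq (leq_maxl k j) kA).
exact: (periodic_leq (leq_maxr k j) jB).
Qed.

Lemma cylinderT : cylinder setT. Proof. by exists 0%N. Qed.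
Lemma cylinder0 : cylinder set0. Proof. by exists 0%N. Qed.

Lemma periodic_translate k A x : periodic k A -> periodic k [set y | A (y - x)].
Proof. by move=> kA y z /= Ay; rewrite addrAC; apply: kA. Qed.

Lemma cylinder_translate A x : cylinder A -> cylinder [set y | A (y - x)].
Proof. by move=> [k /periodic_translate kA]; exists k. Qed.

Lemma vge_vector k x : (forall i, vge k (x i 0)) -> exists z, x = pi ^+ k *: z.
Proof.
move=> kx; have /choice[f fP] i : exists b, x i 0 = pi ^+ k * b.
  exact/(vgeP pi_unif).
by exists (\col_i f i); apply/matrixP => i j; rewrite !ord1 !mxE.
Qed.

Lemma cylinder_measurable A : cylinder A -> measurable (A : set (Rn K n)).
Proof.
move=> [k kA]; apply: sub_sigma_algebra => x Ax; exists k => y yx.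
have [z zE] : exists z, y - x = pi ^+ k *: z by apply: vge_vector => i; apply: yx.
by rewrite -(subrK x y) zE addrC; apply: kA.
Qed.

Definition vol A : T := fine (mu (A : set (Rn K n))).

Lemma mu_fin A : cylinder A -> mu (A : set (Rn K n)) \is a fin_num.
Proof.
move=> cA; rewrite ge0_fin_numE//; apply: le_lt_trans (ltry 1).
have [<- _] := mu_haar; apply: le_measure; rewrite ?inE//.
exact: cylinder_measurable.
Qed.

(** Finite additivity on cylinders is enough for uniqueness, and it passes easily to images under
    matrices. *)
Definition additive_content (nu : set V -> T) := forall A B,
  cylinder A -> cylinder B -> A `&` B = set0 -> nu (A `|` B) = nu A + nu B.
Definition invariant_content (nu : set V -> T) := forall x A,
  cylinder A -> nu [set y | A (y - x)] = nu A.

Lemma vol_additive : additive_content vol.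
Proof.
move=> A B cA cB AB0; rewrite /vol measureU//; try exact: cylinder_measurable.
by rewrite fineD//; exact: mu_fin.
Qed.

Lemma vol_invariant : invariant_content vol.
Proof.
move=> x A cA; have [_ /(_ x A (cylinder_measurable cA)) E] := mu_haar.
rewrite /vol -E; congr (fine (mu _)); apply/seteqP; split=> y /=.
  by exists (y - x) => //; rewrite addrC subrK.
by move=> [z Az <-]; rewrite addrAC subrr add0r.
Qed.

Lemma volT : vol setT = 1.
Proof. by rewrite /vol; have [-> _] := mu_haar. Qed.

Section Content.
Variable nu : set V -> T.
Hypothesis nuD : additive_content nu.

Lemma content0 : nu set0 = 0.
Proof.
have := nuD cylinder0 cylinder0 (setI0 _); rewrite setU0 => /eqP.
by rewrite -subr_eq subrr eq_sym => /eqP.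
Qed.

Lemma content_partition (I : finType) A (B : I -> set V) :
  (forall i, cylinder (B i)) -> (forall (i j : I) x, B i x -> B j x -> i = j) ->
  (forall x, A x <-> exists i, B i x) -> nu A = \sum_i nu (B i).
Proof.
move=> cB dB AB.
have cS (s : seq I) : cylinder [set x | exists2 i, i \in s & B i x].
  elim: s => [|i s IH].
    by rewrite (_ : mkset _ = set0); [exact: cylinder0|apply/seteqP; split=> x //= []].
  rewrite (_ : mkset _ = B i `|` [set x | exists2 j, j \in s & B j x]).
    exact: cylinderU.
  apply/seteqP; split=> x /=.
    by move=> [j]; rewrite inE => /orP[/eqP -> |js] Bj; [left|right; exists j].
  by move=> [Bi|[j js Bj]]; [exists i|exists j]; rewrite // inE ?eqxx ?js ?orbT.
have sumS (s : seq I) : uniq s ->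
    nu [set x | exists2 i, i \in s & B i x] = \sum_(i <- s) nu (B i).
  elim: s => [|i s IH] /=.
    move=> _; rewrite big_nil -content0; congr nu.
    by apply/seteqP; split=> x //= [].
  move=> /andP[iNs us]; rewrite big_cons -IH// -nuD//.
    congr nu; apply/seteqP; split=> x /=.
      by move=> [j]; rewrite inE => /orP[/eqP -> |js] Bj; [left|right; exists j].
    by move=> [Bi|[j js Bj]]; [exists i|exists j]; rewrite // inE ?eqxx ?js ?orbT.
  apply/seteqP; split=> x //= [Bi [j js Bj]].
  by move: iNs; rewrite (dB _ _ _ Bi Bj) js.
rewrite -sumS ?index_enum_uniq//; congr nu; apply/seteqP; split=> x /=.
  by move=> /AB[i Bi]; exists i => //; rewrite mem_index_enum.
by move=> [i _ Bi]; apply/AB; exists i.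
Qed.

End Content.

(** * Images of cylinders under matrices that divide a power of pi *)

Definition mximage (M : 'M[R]_n) A : set V := [set M *m y | y in A].

Section MatrixImage.
Variables (M M' : 'M[R]_n) (j : nat).
Hypothesis MM' : M *m M' = (pi ^+ j)%:M.
Hypothesis M'M : M' *m M = (pi ^+ j)%:M.

Lemma mulmx_inj : injective (fun x : V => M *m x).
Proof.
move=> x y /= /(congr1 (mulmx M')); rewrite !mulmxA M'M !mul_scalar_mx.
move=> /matrixP xy; apply/matrixP => i l; have := xy i l; rewrite !mxE.
exact: (mulfI (piX_neq0 pi_unif j)).
Qed.

Lemma periodic_mximage k A : periodic k A -> periodic (k + j) (mximage M A).
Proof.
move=> kA _ z [y Ay <-]; exists (y + pi ^+ k *: (M' *m z)); first exact: kA.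
by rewrite mulmxDr -scalemxAr mulmxA MM' mul_scalar_mx scalerA exprD.
Qed.

Lemma cylinder_mximage A : cylinder A -> cylinder (mximage M A).
Proof. by move=> [k kA]; exists (k + j)%N; apply: periodic_mximage. Qed.

Lemma additive_mximage nu : additive_content nu ->
  additive_content (fun A => nu (mximage M A)).
Proof.
move=> nuD A B cA cB AB0; rewrite -nuD; try exact: cylinder_mximage.
  by rewrite /mximage image_setU.
apply/seteqP; split=> _ //= [[x Ax <-] [y By /mulmx_inj yx]].
have : (A `&` B) x by split=> //; rewrite -yx.
by rewrite AB0.
Qed.

Lemma invariant_mximage nu : invariant_content nu ->
  invariant_content (fun A => nu (mximage M A)).
Proof.
move=> nuI x A cA; rewrite -(nuI (M *m x) (mximage M A))//; last exact: cylinder_mximage.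
congr nu; apply/seteqP; split=> w /=.
  by move=> [y Ay <-]; exists (y - x) => //; rewrite mulmxBr.
move=> [y Ay] /eqP; rewrite eq_sym subr_eq -mulmxDr => /eqP ->.
by exists (y + x) => //=; rewrite addrK.
Qed.

End MatrixImage.

Lemma map_mx_residueE x y : map_mx res x = map_mx res y <-> exists z, x = y + pi *: z.
Proof.
split=> [xy|[z ->]]; last first.
  apply/matrixP => i l; rewrite !mxE rmorphD rmorphM /= (residue_pi pi_unif) mul0r.
  by rewrite addr0.
have [|z zE] := @vge_vector 1 (x - y).
  move=> i; rewrite -residue_vge !mxE rmorphB subr_eq0.
  by have /matrixP/(_ i 0) := xy; rewrite !mxE => ->.
by exists z; rewrite -[pi]expr1 -zE addrC subrK.
Qed.

(** Induction on the level of [A]. Each residue class of [A] is a translate of pi times a set of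
    lower level, to which the induction hypothesis applies. *)
Lemma content_unique nu A : additive_content nu -> invariant_content nu ->
  cylinder A -> nu A = nu setT * vol A.
Proof.
move=> + + [k]; elim: k nu A => [|k IH] nu A nuD nuI kA.
  have [[x Ax]|A0] := pselect (exists x, A x).
    rewrite (_ : A = setT) ?volT ?mulr1//; apply/seteqP; split=> // y _.
    by have := kA x (y - x) Ax; rewrite expr0 scale1r addrC subrK.
  rewrite (_ : A = set0) ?content0 ?mulr0//; first exact: vol_additive.
  by apply/seteqP; split=> // x Ax; apply: A0; exists x.
have [s sK] := res_lift K.
pose S c : V := map_mx s c; pose P : 'M[R]_n := pi%:M.
have SK c : map_mx res (S c) = c by apply/matrixP => i l; rewrite !mxE sK.
have PP : P *m 1%:M = (pi ^+ 1)%:M by rewrite mulmx1 expr1.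
have PP' : 1%:M *m P = (pi ^+ 1)%:M by rewrite mul1mx expr1.
have PE x : P *m x = pi *: x by rewrite mul_scalar_mx.
pose Ac B c : set V := [set y | B (S c + pi *: y)].
have kAc B c : periodic k.+1 B -> periodic k (Ac B c).
  move=> kB x z Bx; rewrite /Ac /= scalerDr scalerA -exprS addrA; exact: kB.
(* The sum does not depend on [nu'], which is what allows the comparison of [nu] with [vol]. *)
have nuE nu' B : additive_content nu' -> invariant_content nu' -> periodic k.+1 B ->
    nu' B = nu' (mximage P setT) * \sum_c vol (Ac B c).
  move=> nuD' nuI' kB.
  rewrite (@content_partition _ nuD' _ B
    (fun c => [set x | mximage P (Ac B c) (x - S c)])).
  - rewrite mulr_sumr; apply: eq_bigr => c _; rewrite nuI'; last first.
      by apply: (cylinder_mximage PP); exists k; apply: kAc.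
    (* The induction hypothesis is used for the content obtained by scaling with pi, not for [nu']
       itself. *)
    apply: (IH (fun A => nu' (mximage P A))).
    + exact: (additive_mximage PP PP').
    + exact: (invariant_mximage PP).
    + exact: kAc.
  - move=> c; apply/cylinder_translate/(cylinder_mximage PP).
    by exists k; apply: kAc.
  - move=> c c' x [y _] /eqP; rewrite PE eq_sym subr_eq addrC => /eqP xE.
    move=> [y' _] /eqP; rewrite PE eq_sym subr_eq addrC => /eqP xE'.
    rewrite -[c]SK -[c']SK; transitivity (map_mx res x).
      by apply/esym/map_mx_residueE; exists y.
    by apply/map_mx_residueE; exists y'.
  - move=> x; split=> [Bx|[c [y]]]; last first.
      by rewrite PE /= => By yE; rewrite -(subrK (S c) x) -yE addrC.
    have [|z zE] := (map_mx_residueE x (S (map_mx res x))).1 _; first by rewrite SK.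
    exists (map_mx res x), z; first by rewrite /Ac /= -zE.
    by rewrite PE; apply/eqP; rewrite eq_sym subr_eq addrC -zE.
(* Comparing the formulas for [A] and [setT] under both contents eliminates the volumes of pi
   R^n. *)
rewrite (nuE nu)// (nuE vol A)//; try exact: vol_additive; try exact: vol_invariant.
have kT : periodic k.+1 setT by [].
have := nuE vol setT vol_additive vol_invariant kT; have := nuE nu setT nuD nuI kT.
rewrite volT => nuTE volTE; rewrite nuTE.
by rewrite -mulrA; congr (_ * _); rewrite mulrCA mulrA -volTE mul1r.
Qed.

Lemma vol_mximage (M M' : 'M[R]_n) j A : M *m M' = (pi ^+ j)%:M ->
  M' *m M = (pi ^+ j)%:M -> cylinder A ->
  vol (mximage M A) = vol (mximage M setT) * vol A.
Proof.
move=> MM' M'M cA; apply: (@content_unique (fun A => vol (mximage M A))) => //.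
  exact: (additive_mximage MM' M'M vol_additive).
exact: (invariant_mximage MM' vol_invariant).
Qed.

Lemma vol_unitmx (M : 'M[R]_n) A : M \in unitmx -> cylinder A ->
  vol (mximage M A) = vol A.
Proof.
move=> uM cA; rewrite (@vol_mximage M (invmx M) 0)//.
- rewrite (_ : mximage M setT = setT) ?volT ?mul1r//.
  apply/seteqP; split=> // x _; exists (invmx M *m x) => //.
  by rewrite mulmxA mulmxV// mul1mx.
- by rewrite mulmxV// expr0.
- by rewrite mulVmx// expr0.
Qed.

Definition fiber c : set V := [set x | map_mx res x = c].

Lemma periodic_fiber c : periodic 1 (fiber c).
Proof.
by move=> x z <-; apply/map_mx_residueE; exists z; rewrite expr1.
Qed.

Lemma cylinder_fiber c : cylinder (fiber c).
Proof. by exists 1%N; apply: periodic_fiber. Qed.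

(** The fibers are translates of one another, and q^n of them partition a set of volume 1. *)
Lemma vol_fiber c : vol (fiber c) = ratr (#|F|%:R ^- n).
Proof.
have [s sK] := res_lift K.
have E c' : vol (fiber c') = vol (fiber 0).
  rewrite -(vol_invariant (map_mx s c') (cylinder_fiber 0)); congr vol.
  have SK : map_mx res (map_mx s c') = c' by apply/matrixP => i l; rewrite !mxE sK.
  apply/seteqP; split=> x; rewrite /fiber /= map_mxB SK.
    by move=> ->; rewrite subrr.
  by move/eqP; rewrite subr_eq0 => /eqP.
have : vol setT = \sum_c vol (fiber c).
  apply: (content_partition vol_additive) => //.
  - exact: cylinder_fiber.
  - by move=> c1 c2 x <- <-.
  - by move=> x; split=> // _; exists (map_mx res x).
rewrite volT; under eq_bigr do rewrite E.
rewrite sumr_const card_mx muln1 E => /esym E1.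
have q0 : (#|F| ^ n)%:R != 0 :> T.
  by rewrite pnatr_eq0 -lt0n expn_gt0 (ltnW (card_finNzRing_gt1 _)).
by apply: (mulfI q0); rewrite mulr_natl E1 fmorphV /= -natrX ratr_nat divff.
Qed.

End Volume.

(** * The volumes attached to a diagonal form satisfy the predicted recursion *)

Section Recursion.
Variables (p : nat) (K : padicField p).
Local Notation R := (valuationRing K).
Local Notation F := (residueField K).
Local Notation res := (residue K).
Hypothesis p_odd : odd p.
Variable pi : R.
Hypothesis pi_unif : uniformizer pi.
Variables (T : realType) (n : nat) (mu : {measure set (Rn K n) -> \bar T}).
Hypothesis mu_haar : normalized_haar mu.
Variables (J : {set 'I_n}) (a : 'I_n -> R).
Hypothesis a_unit : forall i, a i \is a GRing.unit.
Local Notation V := 'cV[R]_n.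
Local Notation W := 'cV[F]_n.
Local Notation q := (#|F|%:R : rat).
Local Notation vol := (vol mu).
Local Notation Q e := (diag_form pi J e a).
Let b i : F := res (a i).
Implicit Types (e : 'I_n -> nat) (k : nat) (x y z : V) (c : W).

Lemma residue_coef_neq0 i : b i != 0.
Proof. by rewrite /b -unit_residue. Qed.

Lemma diag_form_add e x k z :
  exists t, Q e (x + pi ^+ k *: z) = Q e x + pi ^+ k * t.
Proof.
exists (\sum_(i in J)
  pi ^+ e i * a i * (2 * x i 0 * z i 0 + pi ^+ k * z i 0 ^+ 2)).
rewrite /diag_form mulr_sumr -big_split; apply: eq_bigr => i _.
by rewrite !mxE /=; ring.
Qed.

Lemma diag_form_add_delta e x i (u : R) : i \in J ->
  Q e (x + u *: delta_mx i 0) =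
  Q e x + pi ^+ e i * a i * (2 * x i 0 * u + u ^+ 2).
Proof.
move=> iJ; rewrite /diag_form (bigD1 i)//= [in RHS](bigD1 i)//= !mxE !eqxx /=.
rewrite (eq_bigr (fun l => pi ^+ e l * a l * x l 0 ^+ 2)); first by ring.
by move=> l /andP[_ li]; rewrite !mxE (negbTE li) mulr0 addr0.
Qed.

Lemma periodic_div e k : periodic pi k [set x | vge k (Q e x)].
Proof.
move=> x z /= kx; have [t ->] := diag_form_add e x k z.
by rewrite (vgeD pi_unif)// vge_piX.
Qed.

Lemma cylinder_div e k : cylinder pi [set x | vge k (Q e x)].
Proof. by exists k; apply: periodic_div. Qed.

Lemma residue_diag_form e x :
  res (Q e x) = diag_value b (enum (level J e)) (map_mx res x).
Proof.
rewrite /diag_value big_enum rmorph_sum [LHS]big_mkcond [RHS]big_mkcond /=.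
apply: eq_bigr => i _; rewrite inE mxE; case: (i \in J) => //=.
case: (e i) => [|k] /=; first by rewrite expr0 mul1r rmorphM rmorphXn.
by rewrite exprS !rmorphM /= (residue_pi pi_unif) !mul0r.
Qed.

(** The derivative along x_i is a unit on this fiber. Hence translations by multiples of pi^(k+1)
    along x_i cut the points with divisibility k+1 into q translates of those with divisibility
    k+2. *)
Lemma vol_smooth_fiber e c i k : i \in level J e -> c i 0 != 0 ->
  diag_value b (enum (level J e)) c = 0 ->
  vol (fiber c `&` [set x | vge k.+1 (Q e x)]) = ratr (q ^- n * q ^- k).
Proof.
move=> iS ci Qc.
have [iJ ei] : i \in J /\ e i = 0%N by move: iS; rewrite inE => /andP[-> /eqP].
elim: k => [|k IH].
  rewrite expr0 invr1 mulr1 -(vol_fiber pi_unif mu_haar c); congr (vol _).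
  apply/seteqP; split=> x; first by case.
  by move=> xc; split=> //=; rewrite -residue_vge residue_diag_form xc Qc.
have [s sK] := res_lift K.
set A' := fiber c `&` [set x | vge k.+2 (Q e x)].
have two0 := res_two_neq0 K p_odd.
(* Chosen so that the first-order term [2 * a i * y i 0 * t j] has residue [j]. *)
pose t j : R := s (j / (2 * b i * c i 0)).
have cA' : cylinder pi A' by apply: cylinderI; [exact: cylinder_fiber|exact: cylinder_div].
pose B j : set V := [set y | A' (y - (pi ^+ k.+1 * t j) *: delta_mx i 0)].
have BE j y : B j y <-> fiber c y /\ vge k.+2 (Q e y - pi ^+ k.+1 * (2 * a i * y i 0 * t j)).
  have f1 : fiber c (y - (pi ^+ k.+1 * t j) *: delta_mx i 0) <-> fiber c y.
    rewrite -scalerA -scalerN; split=> [yc|<-]; last first.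
      apply/(map_mx_residueE pi_unif); exists (- (pi ^+ k *: (t j *: delta_mx i 0))).
      by rewrite exprS !scalerN !scalerA mulrA.
    rewrite -yc; apply/(map_mx_residueE pi_unif); exists (pi ^+ k *: (t j *: delta_mx i 0)).
    by rewrite scalerN scalerA -exprS subrK.
  have f2 : vge k.+2 (Q e (y - (pi ^+ k.+1 * t j) *: delta_mx i 0)) =
     vge k.+2 (Q e y - pi ^+ k.+1 * (2 * a i * y i 0 * t j)).
    rewrite -scaleNr diag_form_add_delta// ei expr0 mul1r.
    (* The quadratic term is divisible by pi^(2k+2), hence negligible modulo pi^(k+2). *)
    have -> : Q e y + a i * (2 * y i 0 * (- (pi ^+ k.+1 * t j)) + (- (pi ^+ k.+1 * t j)) ^+ 2)
       = Q e y - pi ^+ k.+1 * (2 * a i * y i 0 * t j)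
         + pi ^+ k.+2 * (pi ^+ k * (a i * t j ^+ 2)).
      by rewrite !exprS; ring.
    by rewrite (vge_addr pi_unif)// vge_piX.
  by rewrite /B /A' /= f2; split=> -[/f1 ? ?]; split=> //; apply/f1.
have mE j y : fiber c y -> res (2 * a i * y i 0 * t j) = j.
  move=> /matrixP/(_ i 0); rewrite mxE => yc.
  rewrite !rmorphM /= sK yc rmorph_nat -/(b i).
  by field; rewrite two0 residue_coef_neq0 ci.
have : vol (fiber c `&` [set x | vge k.+1 (Q e x)]) = \sum_(j : F) vol (B j).
  apply: (content_partition (vol_additive pi_unif mu_haar)).
  - by move=> j; apply: cylinder_translate.
  - move=> j j' y /BE[yc jy] /BE[_ j'y].
    rewrite -(mE j y yc) -(mE j' y yc).
    apply/eqP; rewrite -subr_eq0 -rmorphB residue_vge.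
    rewrite -(vge_piXM pi_unif k.+1) addn1.
    have := vgeB pi_unif j'y jy; congr (vge _ _); by ring.
  - move=> y; split=> [[yc /= /(vgeP pi_unif)[w wE]]|[j /BE[yc jy]]].
      exists (res w); apply/BE; split=> //.
      rewrite wE -mulrBr -[k.+2]addn1 (vge_piXM pi_unif) -residue_vge rmorphB.
      by rewrite mE// subrr.
    split=> //=; rewrite -(subrK (pi ^+ k.+1 * (2 * a i * y i 0 * t j)) (Q e y)).
    by rewrite (vgeD pi_unif) ?vge_piX// (vge_leq _ jy).
rewrite IH (eq_bigr (fun=> vol A')); last first.
  by move=> j _; apply: (vol_invariant pi_unif mu_haar).
rewrite sumr_const => E.
have q0 : #|F|%:R != 0 :> T by rewrite pnatr_eq0 -lt0n (ltnW (card_finNzRing_gt1 _)).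
apply: (mulfI q0); rewrite mulr_natl -E -(ratr_nat T #|F|) -rmorphM; congr (ratr _).
by rewrite exprS; field; rewrite ?expf_neq0 ?card_neq0.
Qed.

Lemma vol_residue_pred (P : pred W) (B : set V) : cylinder pi B ->
  vol (B `&` [set x | P (map_mx res x)]) = \sum_(c | P c) vol (fiber c `&` B).
Proof.
move=> cB.
rewrite (content_partition (vol_additive pi_unif mu_haar)
  (B := fun c => if P c then fiber c `&` B else set0)).
- rewrite [RHS]big_mkcond; apply: eq_bigr => c _; case: (P c) => //.
  exact: (content0 (vol_additive pi_unif mu_haar)).
- move=> c; case: (P c); last exact: cylinder0.
  by apply: cylinderI => //; exact: cylinder_fiber.
- by move=> c c' x; case: (P c) => //; case: (P c') => // -[<- _] [<- _].
move=> x; split=> [[Bx /= Px]|[c]].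
  by exists (map_mx res x); rewrite Px.
by case: ifP => // Pc [/= xc Bx]; rewrite xc.
Qed.

Lemma sum_pred_ratr (P : pred W) (t : rat) :
  \sum_(c | P c) ratr (q ^- n * t) = ratr (t * mean (fun c => (P c)%:R)) :> T.
Proof.
rewrite /mean mulrCA mulrA mulr_sumr rmorph_sum [LHS]big_mkcond /=.
by apply: eq_bigr => c _; case: (P c); rewrite ?mulr1// mulr0 rmorph0.
Qed.

Definition scaling e : 'M[R]_n := diag_mx (\row_i if i \in level J e then pi else 1).
(** Its product with [scaling e] is pi, as [vol_mximage] requires. *)
Definition coscaling e : 'M[R]_n := diag_mx (\row_i if i \in level J e then 1 else pi).

Lemma scalingK e : scaling e *m coscaling e = (pi ^+ 1)%:M.
Proof.
rewrite mulmx_diag expr1; apply/matrixP => i l; rewrite !mxE.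
by case: (_ \in _); rewrite ?mulr1 ?mul1r.
Qed.

Lemma coscalingK e : coscaling e *m scaling e = (pi ^+ 1)%:M.
Proof.
rewrite mulmx_diag expr1; apply/matrixP => i l; rewrite !mxE.
by case: (_ \in _); rewrite ?mulr1 ?mul1r.
Qed.

Lemma diag_form_scaling e y : Q e (scaling e *m y) = pi * Q (shift_exp e) y.
Proof.
rewrite /diag_form mulr_sumr; apply: eq_bigr => i iJ.
rewrite mul_diag_mx !mxE inE iJ /shift_exp /=.
by case: (e i) => [|k] /=; rewrite ?expr0 ?exprS ?expr0; ring.
Qed.

Definition residue_zero e c := all (fun i => c i 0 == 0) (enum (level J e)).

Lemma mximage_scaling e :
  mximage (scaling e) setT = [set x | residue_zero e (map_mx res x)].
Proof.
apply/seteqP; split=> x /=.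
  move=> [y _ <-]; apply/allP => i; rewrite mem_enum => iS.
  by rewrite mul_diag_mx !mxE iS rmorphM /= (residue_pi pi_unif) mul0r.
move=> /allP xS.
have /choice[f fP] i : exists u, x i 0 = (if i \in level J e then pi else 1) * u.
  have [iS|iS] := boolP (i \in level J e); last by exists (x i 0); rewrite mul1r.
  have := xS i; rewrite mem_enum => /(_ iS); rewrite mxE residue_vge.
  by move=> /(vgeP pi_unif)[u ->]; exists u; rewrite expr1.
exists (\col_i f i) => //; apply/matrixP => i l.
by rewrite !ord1 mul_diag_mx !mxE fP.
Qed.

Lemma vol_residue_zero e :
  vol [set x | residue_zero e (map_mx res x)] = ratr (q ^- #|level J e|).
Proof.
have := vol_residue_pred (residue_zero e) (cylinderT pi n).
rewrite setTI => ->.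
rewrite (eq_bigr (fun=> ratr (q ^- n * 1))); last first.
  by move=> c _; rewrite setIT mulr1 (vol_fiber pi_unif mu_haar).
by rewrite sum_pred_ratr mul1r mean_coords0 ?enum_uniq// cardE.
Qed.

(** R^n is cut by residues. Those vanishing on the level form the image of [scaling e], where the
    form is pi times the shifted one; the others are handled by [vol_smooth_fiber]. *)
Lemma vol_div_density k e :
  vol [set x | vge k (Q e x)] = ratr (div_density b J k e).
Proof.
elim: k e => [|k IH] e /=.
  rewrite (_ : mkset _ = setT) ?(volT mu_haar) ?rmorph1//.
  by apply/seteqP; split=> // x _ /=; apply: vge0.
set B := [set x | _].
have cB : cylinder pi B := cylinder_div e k.+1.
have := vol_residue_pred predT cB.
rewrite (_ : B `&` _ = B); last by apply/seteqP; split=> // x [].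
move=> ->; rewrite (bigID (residue_zero e)) /= addrC rmorphD; congr (_ + _); last first.
  rewrite -vol_residue_pred//.
  have -> : B `&` [set x | residue_zero e (map_mx res x)] =
      mximage (scaling e) [set y | vge k (Q (shift_exp e) y)].
    rewrite -mximage_scaling; apply/seteqP; split=> x /=.
      move=> [Bx [y _ yx]]; exists y => //=; move: Bx.
      by rewrite -yx /B /= diag_form_scaling -[pi]expr1 -add1n (vge_piXM pi_unif).
    move=> [y Qy <-]; split; last by exists y.
    by rewrite /B /= diag_form_scaling -[pi]expr1 -add1n (vge_piXM pi_unif).
  rewrite (vol_mximage pi_unif mu_haar (scalingK e) (coscalingK e)); last exact: cylinder_div.
  by rewrite IH mximage_scaling vol_residue_zero -rmorphM.
set D := diag_value b (enum (level J e)).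
have zD c : residue_zero e c -> D c = 0.
  move=> /allP c0; rewrite /D /diag_value big_seq big1// => i /c0/eqP ->.
  by rewrite expr0n mulr0.
(* A residue that is not a zero of [D] makes the form a unit and contributes nothing. *)
rewrite (bigID (fun c => D c == 0)) /= [X in _ + X]big1 ?addr0; last first.
  move=> c /andP[_ Dc]; rewrite -(content0 (vol_additive pi_unif mu_haar)).
  congr (vol _); apply/seteqP; split=> // x [xc Bx]; move: Dc.
  by rewrite /D -xc -residue_diag_form residue_vge (vge_leq _ Bx).
rewrite (eq_bigr (fun=> ratr (q ^- n * q ^- k))); last first.
  move=> c /andP[/allPn[i]]; rewrite mem_enum => iS ci /eqP Dc.
  exact: (vol_smooth_fiber _ iS ci Dc).
rewrite (sum_pred_ratr (fun c => ~~ residue_zero e c && (D c == 0))); congr (ratr (_ * _)).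
have two0 := res_two_neq0 K p_odd.
have := mean_coords0 F (enum_uniq (level J e)); rewrite -cardE => <-.
rewrite -(mean_zero_density two0 residue_coef_neq0).
(* Residues vanishing on the level are zeros of [D], so the smooth zeros are counted by a difference
   of densities. *)
rewrite /mean -mulrBr -sumrB; congr (_ * _); apply: eq_bigr => c _.
have := zD c; rewrite -/(residue_zero e c) -/(D c).
by case: (residue_zero e c) => /= [->//|_]; rewrite ?eqxx ?subrr ?subr0.
Qed.

End Recursion.

(** The zero form is divisible by every power of pi, so all its densities equal 1. *)
Lemma zeta_coef_rank0 (F : finFieldType) (n : nat) (b : 'I_n -> F)
    (J : {set 'I_n}) e k :
  (2 : F) != 0 -> #|J| = 0%N -> zeta_coef b J e k = 0.
Proof.
move=> two0 J0.
have level0 e' : #|level J e'| = 0%N.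
  apply/eqP; rewrite -leqn0 -J0 subset_leq_card//.
  by apply/fintype.subsetP => i; rewrite inE => /andP[].
have dens1 l e' : div_density b J l e' = 1.
  elim: l e' => //= l IH e'; rewrite IH level0 /zero_density level0 /=.
  rewrite disc_sign0// expr0 invr1; ring.
by rewrite /zeta_coef !dens1 subrr.
Qed.

(** * Transfer of fractions between real and rational coefficients *)

Section ReducedFraction.
Variables (T : realType) (Z : nat -> T) (z : nat -> rat).
Hypothesis ZE : forall k, Z k = ratr (z k).

Lemma reduced_fractionE f g : reduced_fraction Z f g <->
  [/\ coprimep f g, g.[0] = 1 & series_fraction z f g].
Proof.
have E k : \sum_(i < k.+1) ratr g`_i * Z (k - i)%N =
    ratr (\sum_(i < k.+1) g`_i * z (k - i)%N) :> T.
  by rewrite rmorph_sum; apply: eq_bigr => i _; rewrite ZE -rmorphM.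
split=> -[cfg g0 zfg]; split=> // k.
  by apply: (fmorph_inj (ratr : {rmorphism rat -> T})); rewrite /= -E zfg.
by rewrite E zfg.
Qed.

Lemma reduced_fraction_unique f g f' g' :
  reduced_fraction Z f g -> reduced_fraction Z f' g' -> g' = g.
Proof.
move=> /reduced_fractionE[c1 g1 z1] /reduced_fractionE[c2 g2 z2].
exact: (series_fraction_unique c2 g2 z2 c1 g1 z1).
Qed.

End ReducedFraction.

(** * The Igusa zeta function through a diagonal form, and the list of anisotropic classes *)

Section DiagonalIgusa.
Variables (p : nat) (K : padicField p).
Local Notation R := (valuationRing K).
Local Notation F := (residueField K).
Local Notation res := (residue K).
Local Notation q := (#|F|%:R : rat).
Hypothesis p_odd : odd p.
Variable pi : R.
Hypothesis pi_unif : uniformizer pi.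

(** A unimodular change of variables preserves volume, and valuation k means divisibility by pi^k
    but not by pi^(k+1). *)
Lemma igusa_zeta_diagonal (T : realType) (n : nat)
    (mu : {measure set (Rn K n) -> \bar T}) (Q W : 'M[R]_n)
    (J : {set 'I_n}) (e : 'I_n -> nat) (a : 'I_n -> R) :
  normalized_haar mu -> W \in unitmx -> (forall i, a i \is a GRing.unit) ->
  (forall x, qform Q (W *m x) = diag_form pi J e a x) ->
  forall k, igusa_zeta mu (qform Q) k =
    ratr (zeta_coef (fun i => res (a i)) J e k).
Proof.
move=> mu_haar uW ua QE k.
pose B := [set y | vpi (diag_form pi J e a y) = k%:Z%:E].
have pB : periodic pi k.+1 B.
  move=> x z /vpi_eqP/andP[k1 k2]; apply/vpi_eqP.
  have [t ->] := diag_form_add pi J a e x k.+1 z.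
  have v1 : vge k.+1 (pi ^+ k.+1 * t) by apply: vge_piX.
  have v0 := vge_leq (leqnSn k) v1.
  by rewrite !(vge_addr pi_unif)// k1.
have cB : cylinder pi B by exists k.+1.
rewrite /igusa_zeta -[LHS]/(vol mu [set x | vpi (qform Q x) = k%:Z%:E]).
have -> : [set x | vpi (qform Q x) = k%:Z%:E] = mximage W B.
  apply/seteqP; split=> x /=; last by move=> [y By <-]; rewrite QE.
  move=> Qx; exists (invmx W *m x); last by rewrite mulmxA mulmxV// mul1mx.
  by rewrite /B /= -QE mulmxA mulmxV// mul1mx.
rewrite (vol_unitmx pi_unif mu_haar)// /zeta_coef rmorphB.
have volE j : ratr (div_density (fun i => res (a i)) J j e) =
    vol mu [set x | vge j (diag_form pi J e a x)].
  by rewrite (vol_div_density p_odd pi_unif mu_haar J ua).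
apply/esym/eqP; rewrite subr_eq [X in X == _]volE [X in _ + X]volE; apply/eqP.
rewrite -(vol_additive pi_unif mu_haar)//; last 2 first.
- exact: cylinder_div.
- by apply/seteqP; split=> x //= [/vpi_eqP/andP[_ /negP]].
congr (vol mu _); apply/seteqP; split=> x /=.
  move=> kx; have [k1|k1] := boolP (vge k.+1 (diag_form pi J e a x)).
    by right.
  by left; apply/vpi_eqP; rewrite kx.
by move=> [/vpi_eqP/andP[]//|]; apply: vge_leq.
Qed.

Section RankClass.
Variables (n : nat) (a : 'I_n -> R).
Let b i := res (a i).

Lemma disc_sign_class (S : {set 'I_n}) (d : R) : d \is a GRing.unit ->
  same_class (\prod_(i in S) a i) d ->
  disc_sign b S = quadratic_char (res ((-1) ^+ #|S|./2 * d)).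
Proof.
move=> ud [u uu dE]; rewrite /disc_sign /sign_disc.
have -> : \prod_(i in S) b i = res (d * u ^+ 2) by rewrite -dE rmorph_prod.
rewrite -[RHS](quadratic_char_sqrM _ (_ : res u != 0)) -?unit_residue//.
congr quadratic_char; rewrite !rmorphM !rmorphXn rmorphN1 /=; ring.
Qed.

(** Unit classes are separated by the character of the residue, which is -1 at [alpha]. In rank 1
    both classes are listed; in rank 2 the sign is the character of -d, equal to -1 exactly for the
    class of [- alpha]. *)
Lemma anisotropic_class (S : {set 'I_n}) (d alpha : R) : d \is a GRing.unit ->
  alpha \is a GRing.unit -> ~ unit_square alpha ->
  same_class (\prod_(i in S) a i) d ->
  anisotropic b S <-> in_rank_classes (rank_class_list alpha) (#|S|, d).
Proof.
move=> ud ualpha alphaN dE.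
have two0 := res_two_neq0 K p_odd.
have chi_alpha : quadratic_char (res alpha) = -1.
  by rewrite -(unit_etaE pi_unif p_odd)// /unit_eta; case: asboolP.
have unitN1 : (-1 : R) \is a GRing.unit by rewrite unitrN unitr1.
have chi_d : quadratic_char (res d) = 1 \/ quadratic_char (res d) = -1.
  have : res d != 0 by rewrite -unit_residue.
  by move=> /(quadratic_char_eq_sign two0)/orP[]/eqP; [left|right].
set t := quadratic_char (res (-1)).
have chiN x : quadratic_char (res (- x)) = t * quadratic_char (res x).
  by rewrite -mulN1r rmorphM quadratic_charM.
have tt : t * t = 1.
  by rewrite -expr2 quadratic_char_sqr1// -unit_residue.
rewrite /anisotropic /in_rank_classes /rank_class_list.
split.
  case s: #|S| => [|[|[|]]]//=.
  - move=> _; exists (0%N, 1); first by rewrite inE eqxx.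
    split=> //=; move: dE; rewrite (cards0_eq s) big_set0 => -[u uu E].
    exists u^-1; first by rewrite unitrV.
    by apply: (mulIr (unitrX 2 uu)); rewrite mul1r -exprMn mulVr// expr1n E.
  - move=> _; case: chi_d => chi_d.
      exists (1%N, 1); first by rewrite !inE eqxx ?orbT.
      split=> //=; apply: (same_class_quadratic_char pi_unif p_odd) => //.
        by rewrite unitr1.
      by rewrite rmorph1 quadratic_char1.
    exists (1%N, alpha); first by rewrite !inE eqxx ?orbT.
    split=> //=; apply: (same_class_quadratic_char pi_unif p_odd) => //.
    by rewrite chi_alpha.
  - rewrite (disc_sign_class ud dE) s expr1 mulN1r chiN => /eqP td.
    exists (2%N, - alpha); first by rewrite !inE eqxx ?orbT.
    split=> //=; apply: (same_class_quadratic_char pi_unif p_odd) => //.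
      by rewrite unitrN.
    by rewrite chiN chi_alpha -td mulrA tt mul1r.
move=> [[s c]]; rewrite !inE => + [/= sS dc].
move=> /or4P[]/eqP[sE cE]; rewrite sS sE//=.
rewrite (disc_sign_class ud dE) sS sE expr1 mulN1r chiN.
rewrite (quadratic_char_same_class _ dc) cE ?unitrN// chiN chi_alpha.
by rewrite mulrA tt mul1r.
Qed.

End RankClass.
End DiagonalIgusa.

Theorem theorem2p5 (p : nat) (p_odd : odd p) (K : padicField p)
  (pi : valuationRing K) (pi_unif : uniformizer pi)
  (alpha : valuationRing K) (alpha_unit : alpha \is a GRing.unit)
  (alpha_nonsquare : ~ unit_square alpha)
  (n : nat) (Q : 'M[valuationRing K]_n) (Q_sym : Q^T = Q)
  (rk : nat -> nat) (Qs : forall i : nat, 'M[valuationRing K]_(rk i))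
  (Qs_unimodular : forall i : nat, unimodular (Qs i))
  (N : nat) (Qs_almost_all_zero : forall i : nat, (N <= i)%N -> rk i = 0%N)
  (m : nat) (Q_equiv : qform_equiv Q (jordan_form pi Qs N m))
  (T : realType) (mu : {measure set (Rn K n) -> \bar T})
  (mu_haar : normalized_haar mu) :
  let q : rat := #|residueField K|%:R in
  let r := (\sum_(i < N) rk i)%N in
  let r_even := (\sum_(i < N | ~~ odd i) rk i)%N in
  let r_odd := (\sum_(i < N | odd i) rk i)%N in
  let d : valuationRing K := \prod_(i < N) \det (Qs i) in
  let d_even : valuationRing K := \prod_(i < N | ~~ odd i) \det (Qs i) in
  let d_odd : valuationRing K := \prod_(i < N | odd i) \det (Qs i) in
  let L := rank_class_list alpha in
  let in_L := in_rank_classes L (r_even, d_even) /\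
              in_rank_classes L (r_odd, d_odd) in
  let Z := igusa_zeta mu (qform Q) in
  (exists f g : {poly rat}, reduced_fraction Z f g) /\
  forall f g : {poly rat}, reduced_fraction Z f g ->
  [/\ r = 0%N -> g = 1,
      (0 < r)%N -> in_L ->
        (r_even = r_odd -> g = 1 - (q ^- (r %/ 2)) *: 'X) /\
        (r_even <> r_odd -> g = 1 - (q ^- r) *: 'X^2)
    & (0 < r)%N -> ~ in_L ->
        [/\ odd r_even -> odd r_odd -> g = 1 - q^-1 *: 'X,
            ~~ odd r_even -> ~~ odd r_odd ->
              g = (1 - q^-1 *: 'X) *
                  (1 - (unit_eta ((-1) ^+ (r %/ 2) * d) * q ^- (r %/ 2)) *: 'X)
          & odd r_even <> odd r_odd ->
              g = (1 - q^-1 *: 'X) * (1 - (q ^- r) *: 'X^2)]].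
Proof.
move=> q r r_even r_odd d d_even d_odd L in_L Z.
have [U [V [UV VU QE]]] := Q_equiv.
(* Mutually inverse rectangular matrices are square; after substitution [U] is an invertible
   matrix. *)
have nE : n = (\sum_(i < N) rk i + m)%N.
  by apply/eqP; rewrite eqn_leq (mulmx1_min UV) (mulmx1_min VU).
clear Q_equiv; subst n.
have [W [J [e [a [uW ua eN WE PE]]]]] :=
  jordan_diagonal p_odd pi N m Qs_unimodular.
have uUW : U *m W \in unitmx.
  by rewrite unitmx_mul uW andbT; have [] := mulmx1_unit UV.
have UWE x : qform Q (U *m W *m x) = diag_form pi J e a x.
  by rewrite -WE /qform QE -!mulmxA !trmx_mul !mulmxA.
pose b i := residue K (a i).
pose z := zeta_coef b J e.
have ZE k : Z k = ratr (z k).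
  exact: (igusa_zeta_diagonal p_odd pi_unif mu_haar uUW ua UWE).
have two0 := res_two_neq0 K p_odd.
have b0 i : b i != 0 by rewrite /b -unit_residue.
pose E := even_part J e; pose O := odd_part J e.
have [cE dE] : #|E| = r_even /\ same_class (\prod_(i in E) a i) d_even.
  exact: (PE (fun k => ~~ odd k)).
have [cO dO] : #|O| = r_odd /\ same_class (\prod_(i in O) a i) d_odd.
  exact: (PE odd).
have rE : r = (r_even + r_odd)%N.
  rewrite /r (bigID (fun k : 'I_N => ~~ odd k))/=; congr addn.
  by apply: eq_bigl => k; rewrite negbK.
have ddE : d = d_even * d_odd.
  rewrite /d (bigID (fun k : 'I_N => ~~ odd k))/=; congr (_ * _).
  by apply: eq_bigl => k; rewrite negbK.
have udet i : \det (Qs i) \is a GRing.unit by have [] := Qs_unimodular i.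
have ude : d_even \is a GRing.unit by rewrite unitr_prod.
have udo : d_odd \is a GRing.unit by rewrite unitr_prod.
have anE := anisotropic_class p_odd pi_unif ude alpha_unit alpha_nonsquare dE.
have anO := anisotropic_class p_odd pi_unif udo alpha_unit alpha_nonsquare dO.
have in_LE : in_L <-> anisotropic b E && anisotropic b O.
  rewrite /in_L -cE -cO; split=> [[hE hO]|/andP[hE hO]].
    by apply/andP; split; [apply/anE|apply/anO].
  by split; [apply/anE|apply/anO].
have eM : {in J, forall i, (e i <= N.+1)%N}.
  by move=> i _; rewrite (leq_trans (eN i)).
(* By uniqueness of the reduced denominator, one fraction with the required denominator is
   enough. *)
suff [g0 [[f0 fg0] g0E]] : exists g0, (exists f0, reduced_fraction Z f0 g0) /\
  [/\ r = 0%N -> g0 = 1,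
      (0 < r)%N -> in_L ->
        (r_even = r_odd -> g0 = 1 - (q ^- (r %/ 2)) *: 'X) /\
        (r_even <> r_odd -> g0 = 1 - (q ^- r) *: 'X^2)
    & (0 < r)%N -> ~ in_L ->
        [/\ odd r_even -> odd r_odd -> g0 = 1 - q^-1 *: 'X,
            ~~ odd r_even -> ~~ odd r_odd ->
              g0 = (1 - q^-1 *: 'X) *
                  (1 - (unit_eta ((-1) ^+ (r %/ 2) * d) * q ^- (r %/ 2)) *: 'X)
          & odd r_even <> odd r_odd ->
              g0 = (1 - q^-1 *: 'X) * (1 - (q ^- r) *: 'X^2)]].
  split; first by exists f0, g0.
  by move=> f g fg; rewrite (reduced_fraction_unique ZE fg0 fg).
(* In rank 0 the series vanishes and is represented by 0/1. *)
have [r0|r_gt0] := posnP r.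
  exists 1; split.
    exists 0; apply/(reduced_fractionE ZE); split.
    - exact: coprimep1.
    - by rewrite hornerE.
    - move=> k; rewrite coef0 big1// => i _; rewrite /z zeta_coef_rank0 ?mulr0//.
      have [JE _] := PE predT; apply: etrans (etrans JE r0).
      by apply: eq_card => l; rewrite inE andbT.
  by split; rewrite ?r0.
have EO_gt0 : (0 < #|E| + #|O|)%N by rewrite cE cO -rE.
have [aniso|iso] := boolP (anisotropic b E && anisotropic b O).
  have /andP[aE aO] := aniso.
  have [f zf cf] := zeta_anisotropic two0 b0 eM EO_gt0 aE aO.
  exists (anisotropic_denom (residueField K) E O); split.
    exists f; apply/(reduced_fractionE ZE); split=> //.
    exact: anisotropic_denom0.
  split=> [r0|_ _|_ /(_ (in_LE.2 aniso))]; [by rewrite r0 in r_gt0| |by []].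
  rewrite /anisotropic_denom cE cO; split=> [eo|/eqP/negbTE->].
    by rewrite eo eqxx rE eo addnn -muln2 mulnK.
  by rewrite rE.
have [f zf cf] := zeta_isotropic two0 b0 eM iso.
exists (linear_factor (residueField K) * isotropic_factor b E O); split.
  exists f; apply/(reduced_fractionE ZE); split=> //.
  by rewrite hornerM linear_factor0 isotropic_factor0 mulr1.
split=> [r0|_ /in_LE|_ _]; [by rewrite r0 in r_gt0|by rewrite (negbTE iso)|].
rewrite /isotropic_factor cE cO; split=> [-> ->|oE oO|]; first by rewrite mulr1.
  rewrite (negbTE oE) (negbTE oO) /=.
  have -> : (r %/ 2)%N = (r_even./2 + r_odd./2)%N.
    by rewrite divn2 rE halfD (negbTE oE) add0n.
  congr (_ * (1 - (_ * _) *: _)).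
  rewrite (disc_sign_class ude dE) (disc_sign_class udo dO) cE cO.
  (* Once [unit_eta] is read as the residue character, multiplicativity merges the signs of the even
     and odd parts. *)
  rewrite (unit_etaE pi_unif p_odd); last first.
    by rewrite unitrM unitrX ?unitrN ?unitr1//= ddE unitrM ude udo.
  rewrite -quadratic_charM// -rmorphM ddE exprD; congr (quadratic_char (residue K _)).
  by ring.
case: (odd r_even) (odd r_odd) => [] []//= _; by rewrite rE.
Qed.
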